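(* Let $1<p<\infty$, $w\in A_p$, and let the pair $(\varphi_1,\varphi_2)$ of weights satisfy, with a constant $C_1$ independent of $x$ and $r$, $$\int_r^\infty\frac{\operatorname*{ess\,inf}_{t<s<\infty}\varphi_1(x,s)\,w(B_s(x))^{\frac1p}}{w(B_t(x))^{\frac1p}}\,\frac{dt}{t}\le C_1\,\varphi_2(x,r)\qquad\text{for all }x\in\mathbb{R}^n_+,\ r>0.$$ Let $\widetilde T$ be a sub-linear operator such that, for some constant $C_0$, $$|\widetilde T f(x)|\le C_0\int_{\mathbb{R}^n_+}\frac{|f(y)|}{|\tilde x-y|^n}\,dy\qquad (x\in\mathbb{R}^n_+)$$ for any $f\in L_1(\mathbb{R}^n_+)$ with compact support. If $\widetilde T$ is bounded in $L_{p,w}(\mathbb{R}^n_+)$, then it is bounded from $M_{p,\varphi_1}(\mathbb{R}^n_+,w)$ to $M_{p,\varphi_2}(\mathbb{R}^n_+,w)$ and $$\|\widetilde T f\|_{p,\varphi_2,w;\mathbb{R}^n_+}\le C\,[w]_{A_p}^{\frac1p}\,\|f\|_{p,\varphi_1,w;\mathbb{R}^n_+}$$ with a constant $C$ independent of $f$.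
   Context: $\mathbb{R}^n_+=\{x\in\mathbb{R}^n: x_n>0\}$, and for $x\in\mathbb{R}^n_+$, $\tilde x=(x_1,\dots,x_{n-1},-x_n)$. $B_r(x)$ is the open ball of center $x$ and radius $r$, and $B_r^+(x)=B_r(x)\cap\mathbb{R}^n_+$. A weight is a non-negative locally integrable function on its domain; $w(E)=\int_E w(x)\,dx$ for a weight $w$ on $\mathbb{R}^n$. The weight $w$ belongs to the Muckenhoupt class $A_p$, $1<p<\infty$, if $$[w]_{A_p}=\sup_{B}\left(\frac1{|B|}\int_B w\,dx\right)\left(\frac1{|B|}\int_B w^{-\frac1{p-1}}\,dx\right)^{p-1}<\infty,$$ the supremum being over all balls $B\subset\mathbb{R}^n$. $L_{p,w}(\mathbb{R}^n_+)$ is the space of measurable $f$ with $\left(\int_{\mathbb{R}^n_+}|f|^pw\,dy\right)^{1/p}<\infty$. For a weight $\varphi(x,r)$ with values in $\mathbb{R}_+=(0,\infty)$, $M_{p,\varphi}(\mathbb{R}^n_+,w)$ (generalized weighted Morrey space) consists of all $f\in L_{p,w}^{\rm loc}(\mathbb{R}^n_+)$ with $$\|f\|_{p,\varphi,w;\mathbb{R}^n_+}=\sup_{x\in\mathbb{R}^n_+,\,r>0}\varphi(x,r)^{-1}\left(w(B_r^+(x))^{-1}\int_{B_r^+(x)}|f(y)|^pw(y)\,dy\right)^{\frac1p}<\infty.$$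
   Formalization: As stated, T is unconstrained on Morrey functions outside L_{p,w}, so the claim fails; the formal theorem adds that for f in M_{p,φ1} not in L_{p,w}, |Tf| ≤ liminf_k |T(f·1_{B_k(0)})| a.e. in the half-space. *)

(* Defs.v *)
From HB Require Import structures.
From mathcomp Require Import all_boot all_order all_algebra.
From mathcomp Require Import all_classical all_reals all_analysis ess_sup_inf.
Set Implicit Arguments.
Unset Strict Implicit.
Unset Printing Implicit Defensive.
Import Order.TTheory GRing.Theory Num.Theory.
Import numFieldNormedType.Exports.
Local Open Scope classical_set_scope.
Local Open Scope ring_scope.

(* R^n as n-tuples: the library provides the product Borel sigma-algebra on
   tuples but a topology only on 'rV[R]_n, so the latter is pulled back. *)
Definition rvec (R : realType) (n : nat) := n.-tuple (measurableTypeR R).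

Section rvec_instances.
Context (R : realType) (n : nat).
Local Notation V := (rvec R n).

HB.instance Definition _ := Measurable.copy V (n.-tuple (measurableTypeR R)).

Definition row_of_rvec (x : V) : 'rV[R]_n := \row_i (tnth x i : R).

HB.instance Definition _ := Topological.copy V (initial_topology row_of_rvec).

End rvec_instances.

Section lebesgue.
Context (R : realType).

Definition rvec_cons n (z : measurableTypeR R * rvec R n) : rvec R n.+1 :=
  [tuple of z.1 :: z.2].

Lemma measurable_rvec_cons n : measurable_fun setT (@rvec_cons n).
Proof. exact: (@measurable_cons _ _ _ _ fst n snd). Qed.

Section step.
Context (n : nat) (m : {sigma_finite_measure set (rvec R n) -> \bar R}).

Let mu1 : {sigma_finite_measure set (measurableTypeR R) -> \bar R} :=
  lebesgue_measure.

Definition leb_step : set (rvec R n.+1) -> \bar R :=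
  pushforward (mu1 \x m)%E (@rvec_cons n).

Let step0 : leb_step set0 = 0%E.
Proof. by rewrite /leb_step /pushforward preimage_set0 measure0. Qed.

Let step_ge0 A : (0 <= leb_step A)%E.
Proof. by rewrite /leb_step /pushforward; apply: measure_ge0. Qed.

Let mpre (A : set (rvec R n.+1)) :
  measurable A -> measurable (@rvec_cons n @^-1` A).
Proof.
by move=> mA; rewrite -[X in measurable X]setTI; exact: measurable_rvec_cons.
Qed.

Let step_sigma_additive : semi_sigma_additive leb_step.
Proof.
move=> F mF tF mUF; rewrite /leb_step /pushforward preimage_bigcup.
apply: measure_semi_sigma_additive.
- by move=> k; exact: mpre.
- apply/trivIsetP => /= i j _ _ ij; rewrite -preimage_setI.
  by move/trivIsetP : tF => /(_ _ _ _ _ ij) ->//; rewrite preimage_set0.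
- by rewrite -preimage_bigcup; exact: mpre.
Qed.

HB.instance Definition _ := isMeasure.Build _ _ _ leb_step
  step0 step_ge0 step_sigma_additive.

Let step_sigma_finite : sigma_finite setT leb_step.
Proof.
have /sigma_finiteP[F [TF ndF Foo]] := sigma_finiteT mu1.
have /sigma_finiteP[G [TG ndG Goo]] := sigma_finiteT m.
pose tl (x : rvec R n.+1) : rvec R n := [tuple of behead x].
have mtl : measurable_fun setT tl by exact: measurable_behead.
have mhd : measurable_fun setT (fun x : rvec R n.+1 => tnth x ord0).
  exact: measurable_tnth.
have FGE k : @rvec_cons n @^-1`
    ((fun x => tnth x ord0) @^-1` F k `&` tl @^-1` G k) = F k `*` G k.
  apply/seteqP; split=> -[a t] /=.
    by move=> [Fa Gt]; split=> //; congr (G k _): Gt; exact/val_inj.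
  by move=> [Fa Gt]; split=> //; congr (G k _): Gt; exact/val_inj.
exists (fun k => (fun x => tnth x ord0) @^-1` F k `&` tl @^-1` G k).
  apply/esym/seteqP; split=> // x _.
  have : setT (tnth x ord0) by [].
  rewrite TF => -[i _ Fi].
  have : setT (tl x) by [].
  rewrite TG => -[j _ Gj].
  exists (maxn i j) => //; split => /=.
    by move: Fi; exact/subsetPset/ndF/leq_maxl.
  by move: Gj; exact/subsetPset/ndG/leq_maxr.
move=> k; have [mF Foo_k] := Foo k; have [mG Goo_k] := Goo k; split.
  by apply: measurableI; rewrite -[X in measurable X]setTI; [exact: mhd|exact: mtl].
rewrite /leb_step /pushforward FGE product_measure1E//.
by rewrite lte_mul_pinfty// ge0_fin_numE.
Qed.

HB.instance Definition _ := Measure_isSigmaFinite.Build _ _ _ leb_step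
  step_sigma_finite.

End step.

(* [lebesgue_rvec_box] characterizes it as the product measure. *)
Fixpoint lebesgue_rvec n : {sigma_finite_measure set (rvec R n) -> \bar R} :=
  if n is n'.+1 then leb_step (lebesgue_rvec n') else dirac ([tuple] : rvec R 0).

Lemma measurable_rvec_box n (A : 'I_n -> set (measurableTypeR R)) :
  (forall i, measurable (A i)) ->
  measurable [set x : rvec R n | forall i, A i (tnth x i)].
Proof.
move=> mA.
rewrite (_ : mkset _ = \bigcap_i ((@tnth n _ ^~ i) @^-1` A i)).
  apply: fin_bigcap_measurable; first exact: finite_finset.
  move=> i _; rewrite -[X in measurable X]setTI.
  exact: (measurable_tnth i measurableT (mA i)).
by apply/seteqP; split=> x /= Ax i; [move=> _; exact: Ax|exact: Ax].
Qed.

Lemma lebesgue_rvec_box n (A : 'I_n -> set (measurableTypeR R)) :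
  (forall i, measurable (A i)) ->
  lebesgue_rvec n [set x | forall i, A i (tnth x i)] =
  (\prod_(i < n) (lebesgue_measure (A i) : \bar R))%E.
Proof.
elim: n A => [|n IH] A mA /=.
  rewrite big_ord0 diracE mem_set//; by case.
rewrite big_ord_recl -IH//= /leb_step /pushforward.
have mA' : measurable [set x : rvec R n | forall i, A (lift ord0 i) (tnth x i)].
  exact: (@measurable_rvec_box n (fun i => A (lift ord0 i)) (fun i => mA _)).
rewrite -product_measure1E//.
congr (_ _); apply/seteqP; split=> -[a t] /=.
  move=> At; split; first by have := At ord0.
  by move=> i; have := At (lift ord0 i); rewrite tnthS.
move=> [Aa At] i; case: (unliftP ord0 i) => [j|] ->; last exact: Aa.
by rewrite tnthS; exact: At.
Qed.
End lebesgue.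

Section weighted_morrey.
Context (R : realType) (n : nat).
Local Notation V := (rvec R n.+1).
Local Notation mu := (lebesgue_rvec R n.+1).
Local Notation leb := (@lebesgue_measure R).
Implicit Types (x y : V) (r p : R) (w f g : V -> R) (phi : V -> R -> R)
  (D : set (V -> R)) (T : (V -> R) -> V -> R).

Definition hspace : set V := [set x | 0 < (tnth x ord_max : R)].

Definition vrefl x : V :=
  [tuple if i == ord_max then - (tnth x i : R) else tnth x i | i < n.+1].

Definition vdist x y : R :=
  Num.sqrt (\sum_(i < n.+1) ((tnth x i : R) - tnth y i) ^+ 2).

Definition eball x r : set V := [set y | vdist x y < r].

Definition hball x r : set V := eball x r `&` hspace.

Definition weight w : Prop :=
  [/\ measurable_fun setT w, forall x, 0 <= w x &
      forall K : set V, compact K -> (\int[mu]_(x in K) `|w x|%:E < +oo)%E].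

Definition hspace_radii : set (V * measurableTypeR R) :=
  hspace `*` [set r | 0 < (r : R)].

Definition positive_weight phi : Prop :=
  let phi' (q : V * measurableTypeR R) : R := phi q.1 q.2 in
  [/\ measurable_fun hspace_radii phi',
      forall q, hspace_radii q -> 0 < phi' q &
      forall K : set (V * measurableTypeR R), K `<=` hspace_radii -> compact K ->
        (\int[mu \x leb]_(q in K) `|phi' q|%:E < +oo)%E].

Local Open Scope ereal_scope.

Definition wmeas w (A : set V) : \bar R := \int[mu]_(x in A) (w x)%:E.

(* The inverse is taken in \bar R, so that w^(-1/(p-1)) = +oo where w = 0;
   the real power [powR] would give 0 there. *)
Definition Ap_const p w : \bar R :=
  ereal_sup [set ((mu (eball q.1 q.2))^-1 * wmeas w (eball q.1 q.2)) *
      ((mu (eball q.1 q.2))^-1 *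
        \int[mu]_(x in eball q.1 q.2) ((w x)%:E `^ (p - 1)^-1)^-1) `^ (p - 1)
    | q in [set q : V * R | (0 < q.2)%R]].

Definition Muckenhoupt p w : Prop := weight w /\ Ap_const p w < +oo.

(* Functions on the half-space are represented by functions on R^n of which
   only the restriction to [hspace] matters. *)
Definition Lpw_norm p w f : \bar R :=
  (\int[mu]_(x in hspace) (`|f x| `^ p * w x)%:E) `^ p^-1.

Definition Lpw p w f : Prop := measurable_fun hspace f /\ Lpw_norm p w f < +oo.

Definition Lpw_loc p w f : Prop := measurable_fun hspace f /\
  forall K : set V, K `<=` hspace -> compact K ->
    \int[mu]_(x in K) (`|f x| `^ p * w x)%:E < +oo.

Definition morrey_norm p phi w f : \bar R :=
  ereal_sup [set (phi q.1 q.2)^-1%:E *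
      ((wmeas w (hball q.1 q.2))^-1 *
        \int[mu]_(y in hball q.1 q.2) (`|f y| `^ p * w y)%:E) `^ p^-1
    | q in [set q : V * R | hspace q.1 /\ (0 < q.2)%R]].

Definition morrey p phi w f : Prop :=
  Lpw_loc p w f /\ morrey_norm p phi w f < +oo.

Definition ess_inf_gt (t : R) (h : R -> \bar R) : \bar R :=
  ess_inf (mrestr leb (@measurable_itv R `]t, +oo[)) h.

Definition weight_pair_condition p w phi1 phi2 (C1 : R) : Prop :=
  forall x r, hspace x -> (0 < r)%R ->
  \int[leb]_(t in `]r, +oo[)
     (ess_inf_gt t (fun s => (phi1 x s)%:E * wmeas w (eball x s) `^ p^-1)
       / wmeas w (eball x t) `^ p^-1 * t^-1%:E)
  <= (C1 * phi2 x r)%:E.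

Definition L1_compact_support f : Prop :=
  mu.-integrable hspace (EFin \o f) /\
  exists K : set V, [/\ compact K, K `<=` hspace &
    forall x, hspace x -> ~ K x -> f x = 0%R].

Definition linear_space D : Prop :=
  [/\ D (fun=> 0%R), forall f g, D f -> D g -> D (fun x => f x + g x)%R &
      forall (c : R) f, D f -> D (fun x => c * f x)%R].

Definition sublinear_on D T : Prop :=
  [/\ forall f, D f -> measurable_fun hspace (T f),
      forall f g, D f -> D g -> {ae mu, forall x, hspace x ->
        (`|T (fun z => f z + g z) x| <= `|T f x| + `|T g x|)%R} &
      forall (c : R) f, D f -> {ae mu, forall x, hspace x ->
        (`|T (fun z => c * f z) x| = `|c| * `|T f x|)%R}].

Definition size_condition T (C0 : R) : Prop :=
  forall f, L1_compact_support f -> {ae mu, forall x, hspace x ->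
    `|T f x|%:E <= C0%:E *
      \int[mu]_(y in hspace) (`|f y| / vdist (vrefl x) y ^+ n.+1)%:E}.

(* Truncations to balls of a function in a Morrey space are in L_{p,w}.  The size
   condition and boundedness on L_{p,w} leave T f arbitrary for f outside
   L_{p,w} (take T f = l(f) g, with l a linear form vanishing on L_{p,w} and on
   the compactly supported functions of L_1); this is how such a T f is tied to
   the values of T on L_{p,w}. *)
Definition dominated_by_truncations T f : Prop :=
  {ae mu, forall x, hspace x ->
    `|T f x|%:E <=
      limn_einf (fun k : nat => `|T (f \_ (eball [tuple of nseq _ 0%R] k%:R)) x|%:E)}.

Definition bounded_on_Lpw p w T : Prop :=
  exists A : R, forall f, Lpw p w f ->
    Lpw p w (T f) /\ Lpw_norm p w (T f) <= A%:E * Lpw_norm p w f.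

End weighted_morrey.

(* Main.v *)
Require Import Defs.
From mathcomp Require Import all_boot all_order all_algebra.
From mathcomp Require Import all_classical all_reals all_analysis.
From mathcomp Require Import measurable_realfun ring lra.
Import Order.TTheory GRing.Theory Num.Theory.
Import numFieldNormedType.Exports.
Local Open Scope classical_set_scope.
Local Open Scope ring_scope.

(** The exhaustion involves no limit of T along functions: g in L_{p,w} is cut exactly into a part
    in B_1, a part in a compact box outside B_1, and a tail outside the box. The bound for the
    middle part does not depend on the box, and the tail has small L_{p,w} norm, so boundedness of T
    makes its contribution arbitrarily small. Integrals of p-th powers are estimated throughout, at
    the price of factors 2^p, because they add up over pieces without roots. The convention 0 * +oo
    = 0 in \bar R lets w = 0 a.e. into the class A_p, and no division by w(B) is possible there. A
    dichotomy isolates this case, in which every integral against w vanishes; otherwise w > 0 a.e.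
    and every ball has positive finite weight. The constant may depend on w, as do the doubling
    constant and the norm of T on L_{p,w}. The factor [w]^(1/p) is therefore produced at the very
    end, by dividing a constant by it, which requires [w] > 0. *)

(* Fix a half-ball B^+ of radius r centred at x0 and let B_k be the ball of
   radius 2^k r about x0.  Hoelder's inequality and the A_p condition give
   int_{B_k^+} |f| <= [w]^(1/p) |B_k| a_k with a_k = (w(B_k)^-1 int_{B_k^+} |f|^p w)^(1/p),
   so the size condition and |x~ - y| >= |x - y| bound T of the part of f outside
   B_1, pointwise on B^+, by a multiple of the sum of the a_k; the part inside B_1
   is handled by boundedness on L_{p,w} and doubling.  Since int_{B_t^+} |f|^p w is
   nondecreasing in t, it is dominated by the essential infimum in the hypothesis
   on (phi1, phi2), and splitting that integral dyadically bounds the sum of the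
   a_k by a multiple of phi2(x0, r) ||f||.
   The size condition only concerns compact supports inside the open half-space:
   functions of L_{p,w} are reached through a compact exhaustion, the other
   functions of the Morrey space by truncation and Fatou's lemma. *)

(** * Integral inequalities *)

(** A sum is at most twice its larger term. This stands in for Minkowski's inequality when T is
    estimated on a sum of pieces. *)
Lemma powRD_le (R : realType) (p a b : R) : 0 <= p -> 0 <= a -> 0 <= b ->
  (a + b) `^ p <= 2 `^ p * (a `^ p + b `^ p).
Proof.
move=> p0 a0 b0.
have key c d : 0 <= c -> 0 <= d -> c <= d ->
    (c + d) `^ p <= 2 `^ p * (c `^ p + d `^ p).
  move=> c0 d0 cd; apply: (@le_trans _ _ (2 `^ p * d `^ p)).
    rewrite -powRM//; apply: ge0_ler_powR => //; rewrite ?nnegrE ?addr_ge0 ?mulr_ge0//.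
    by rewrite mulr_natl mulr2n lerD2r.
  by rewrite ler_wpM2l ?powR_ge0// lerDr powR_ge0.
have [ab|/ltW ba] := leP a b; first exact: key.
by rewrite addrC [in leRHS]addrC; exact: key.
Qed.

Section integral_facts.
Context {d} {T : measurableType d} {R : realType} (mu : {measure set T -> \bar R}).
Local Open Scope ereal_scope.

(* [ge0_le_integral] would require the integrand of [weight_pair_condition] to be
   measurable. *)
Lemma ge0_le_integral_dom (D : set T) (f g : T -> \bar R) :
  (forall x, D x -> 0 <= f x) -> (forall x, D x -> f x <= g x) ->
  \int[mu]_(x in D) f x <= \int[mu]_(x in D) g x.
Proof.
move=> f0 fg.
have g0 x : D x -> 0 <= g x by move=> Dx; rewrite (le_trans (f0 _ Dx)) ?fg.
rewrite !ge0_integralE//; apply: le_ereal_sup => _ /= [h hf <-].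
exists h => // x; apply: (le_trans (hf x)); rewrite /patch.
by case: ifPn => // /set_mem; exact: fg.
Qed.

(** Hölder's inequality for the factors |g| w^(1/p) and w^(-1/p) with exponents p and q = p/(p-1),
    raised to the power p; the q-th power of the second factor is w^(-1/(p-1)). Positivity of w a.e.
    makes the product of the factors equal to |g|. *)
Lemma weighted_hoelder (D : set T) (g w : T -> R) (p : R) : (1 < p)%R ->
  measurable D -> measurable_fun D g -> measurable_fun D w ->
  (forall x, 0 <= w x)%R -> {ae mu, forall x, D x -> 0 < w x}%R ->
  (\int[mu]_(x in D) `|g x|%:E) `^ p <=
  \int[mu]_(x in D) (`|g x| `^ p * w x)%:E *
  (\int[mu]_(x in D) ((w x)%:E `^ (p - 1)^-1)^-1) `^ (p - 1).
Proof.
move=> p1 mD mg mw w0 wpos.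
have p0 : (0 < p)%R by exact: lt_trans p1.
have p10 : (0 < p - 1)%R by rewrite subr_gt0.
pose q := (p / (p - 1))%R.
have q0 : (0 < q)%R by rewrite divr_gt0.
have pq : (p^-1 + q^-1 = 1)%R by rewrite /q; field; rewrite !gt_eqF.
pose F := ((fun x => `|g x| * w x `^ p^-1)%R \_ D).
pose G := ((fun x => (w x `^ p^-1)^-1)%R \_ D).
have mwp : measurable_fun D (fun x => w x `^ p^-1)%R.
  exact: (measurableT_comp (measurable_powR _)).
have mF : measurable_fun setT F.
  apply/(measurable_restrictT _ mD); apply: measurable_funM => //.
  exact: (measurableT_comp (@normr_measurable _ setT)).
have mG : measurable_fun setT G.
  apply/(measurable_restrictT _ mD).
  have := measurableT_comp (@measurable_powR R (-1)%R) mwp.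
  apply: eq_measurable_fun => x Dx /=.
  by rewrite powR_inv1// powR_ge0.
have := hoelder mu mF mG p0 q0 pq.
rewrite Lnorm1.
have -> : \int[mu]_x `| (EFin \o (F \* G)%R) x| = \int[mu]_(x in D) `|g x|%:E.
  rewrite [RHS]integral_mkcond.
  apply: ge0_ae_eq_integral => //.
  - by apply/measurable_EFinP/measurableT_comp => //; apply: measurable_funM.
  - apply/(measurable_restrictT _ mD); apply/measurable_EFinP.
    exact: (measurableT_comp (@normr_measurable _ setT)).
  - by move=> x _; rewrite /patch; case: ifP.
  apply: filterS wpos => x wx _ /=; rewrite /F /G /patch.
  case: ifPn => [/set_mem /wx {}wx|_]; last by rewrite mulr0 normr0.
  have wp : (w x `^ p^-1 != 0)%R by rewrite gt_eqF// powR_gt0.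
  by rewrite -mulrA divff// mulr1 normr_id.
have NF : 'N[mu]_p%:E [EFin \o F] = (\int[mu]_(x in D) (`|g x| `^ p * w x)%:E) `^ p^-1.
  rewrite unlock /=; congr (_ `^ _).
  rewrite [RHS]integral_mkcond; apply: eq_integral => x _.
  rewrite /F /patch; case: ifPn => _ /=; last by rewrite normr0 powR0// gt_eqF.
  rewrite ger0_norm ?mulr_ge0 ?powR_ge0// powRM ?powR_ge0//.
  by rewrite -powRrM mulVf ?gt_eqF// powRr1.
(* Only an inequality: where w = 0 the real inverse inside [G] is 0, while the inverse in \bar R is
   +oo. *)
have NG : 'N[mu]_q%:E [EFin \o G] <= (\int[mu]_(x in D) ((w x)%:E `^ (p - 1)^-1)^-1) `^ q^-1.
  rewrite unlock /=.
  apply: gt0_ler_poweR; rewrite ?invr_ge0 ?(ltW q0)// ?in_itv/= ?leey ?andbT.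
  - by apply: integral_ge0 => x _; rewrite lee_fin powR_ge0.
  - by apply: integral_ge0 => x _; rewrite inve_ge0 lee_fin powR_ge0.
  rewrite [leRHS]integral_mkcond; apply: ge0_le_integral_dom => x _ /=.
    by rewrite lee_fin powR_ge0.
  rewrite /G /patch; case: ifPn => _; last by rewrite normr0 powR0// gt_eqF.
  rewrite inver; case: ifPn => [_|]; first exact: leey.
  rewrite powR_eq0 negb_and => wx; have {}wx : (0 < w x)%R.
    by rewrite lt0r w0 andbT; case/orP: wx => //; rewrite invr_eq0 gt_eqF.
  rewrite lee_fin ger0_norm ?invr_ge0 ?powR_ge0// -!(powR_inv1 (powR_ge0 (w x) _)).
  rewrite -!powRrM le_eqVlt; apply/orP; left; apply/eqP; congr (_ `^ _)%R.
  by rewrite /q; field; rewrite !gt_eqF.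
rewrite NF => /le_trans /(_ (lee_wpmul2l (poweR_ge0 _ _) NG)).
move=> /(@gt0_ler_poweR _ p (ltW p0)); rewrite !in_itv/= !leey !andbT.
rewrite mule_ge0 ?poweR_ge0// => /(_ (integral_ge0 _ _) isT).
rewrite poweRM ?poweR_ge0// -!poweRrM mulVf ?gt_eqF// poweRe1; last first.
  by apply: integral_ge0 => x _; rewrite lee_fin mulr_ge0 ?powR_ge0.
have -> : (q^-1 * p = p - 1)%R by rewrite /q; field; rewrite !gt_eqF.
apply=> x _; by rewrite lee_fin.
Qed.

End integral_facts.

(** * Euclidean balls *)

(** Lagrange's identity: the defect in the inequality is half the sum of the squares (a_i b_j - a_j
    b_i)^2. *)
Lemma sum_sqr_cauchy (R : realType) (I : finType) (a b : I -> R) :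
  (\sum_i a i * b i) ^+ 2 <= (\sum_i a i ^+ 2) * (\sum_i b i ^+ 2).
Proof.
have : 0 <= \sum_i \sum_j (a i * b j - a j * b i) ^+ 2.
  by apply: sumr_ge0 => i _; apply: sumr_ge0 => j _; exact: sqr_ge0.
have -> : \sum_i \sum_j (a i * b j - a j * b i) ^+ 2 =
    2 * ((\sum_i a i ^+ 2) * (\sum_i b i ^+ 2) - (\sum_i a i * b i) ^+ 2).
  have E (f g : I -> R) : (\sum_i f i) * (\sum_j g j) = \sum_i \sum_j f i * g j.
    by rewrite mulr_suml; apply: eq_bigr => i _; rewrite mulr_sumr.
  have F (u v z : R) : 2 * (u * v - z ^+ 2) = u * v + v * u - (z * z + z * z) by ring.
  rewrite F !E.
  rewrite -!big_split -sumrB; apply: eq_bigr => i _.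
  rewrite -!big_split -sumrB; apply: eq_bigr => j _ /=.
  by ring.
by rewrite pmulr_rge0 ?ltr0n// subr_ge0.
Qed.

Section geometry.
Context {R : realType} {n : nat}.
Local Notation V := (rvec R n.+1).
Local Notation mu := (lebesgue_rvec R n.+1).
Implicit Types x y z c : V.

Local Notation sqd x y := (\sum_(i < n.+1) ((tnth x i : R) - tnth y i) ^+ 2).

Let sqd_ge0 x y : 0 <= sqd x y.
Proof. by apply: sumr_ge0 => i _; exact: sqr_ge0. Qed.

Lemma vdist_ge0 x y : 0 <= vdist x y. Proof. exact: sqrtr_ge0. Qed.

Lemma vdist_sqr x y : vdist x y ^+ 2 = sqd x y.
Proof. by rewrite sqr_sqrtr. Qed.

Lemma vdistxx x : vdist x x = 0.
Proof. by rewrite /vdist big1 ?sqrtr0// => i _; rewrite subrr expr0n. Qed.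

Lemma vdistC x y : vdist x y = vdist y x.
Proof. by rewrite /vdist; congr Num.sqrt; apply: eq_bigr => i _; ring. Qed.

Lemma vdist_triangle x y z : vdist x z <= vdist x y + vdist y z.
Proof.
rewrite -(@ler_pXn2r _ 2)// ?nnegrE ?addr_ge0 ?vdist_ge0//.
rewrite sqrrD !vdist_sqr.
have CS : \sum_i ((tnth x i : R) - tnth y i) * ((tnth y i : R) - tnth z i) <=
    vdist x y * vdist y z.
  apply: (le_trans (ler_norm _)).
  rewrite -(@ler_pXn2r _ 2)// ?nnegrE ?mulr_ge0 ?vdist_ge0//.
  by rewrite exprMn !vdist_sqr real_normK ?num_real//; exact: sum_sqr_cauchy.
have -> : sqd x z = sqd x y +
    (\sum_i ((tnth x i : R) - tnth y i) * ((tnth y i : R) - tnth z i)) *+ 2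
    + sqd y z.
  rewrite -sumrMnl -!big_split /=; apply: eq_bigr => i _; ring.
by rewrite lerD2r lerD2l lerMn2r orbC CS.
Qed.

Lemma coord_le_vdist x y i : `|(tnth x i : R) - tnth y i| <= vdist x y.
Proof.
rewrite -(@ler_pXn2r _ 2)// ?nnegrE ?vdist_ge0// vdist_sqr real_normK ?num_real//.
by rewrite (bigD1 i)//= lerDl sumr_ge0// => j _; exact: sqr_ge0.
Qed.

(** With m coordinates, the squared distance is below m (e/m)^2 = e^2/m, hence below e^2. *)
Lemma vdist_lt_coord x y (e : R) : 0 < e ->
  (forall i, `|(tnth x i : R) - tnth y i| < e / n.+1%:R) -> vdist x y < e.
Proof.
move=> e0 h; rewrite -(@ltr_pXn2r _ 2)// ?nnegrE ?vdist_ge0 ?(ltW e0)// vdist_sqr.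
apply: (@lt_le_trans _ _ (\sum_(i < n.+1) (e / n.+1%:R) ^+ 2)).
  apply: ltr_sum => [|i _]; first by apply/hasP; exists ord0; rewrite ?mem_index_enum.
  by rewrite -real_normK ?num_real// ltr_pXn2r// nnegrE// divr_ge0// ltW.
rewrite sumr_const card_ord -[leLHS]mulr_natl exprMn exprVn mulrCA.
by rewrite ler_piMr ?sqr_ge0// ler_pdivrMr ?exprn_gt0// mul1r -natrX ler_nat (@leq_pexp2l n.+1 1 2).
Qed.

Lemma eball_sub x y (r s : R) : vdist y x + r <= s -> eball x r `<=` eball y s.
Proof.
move=> h z; rewrite /eball /= => xz; apply: (lt_le_trans _ h).
by apply: (le_lt_trans (vdist_triangle _ x _)); rewrite ltrD2l.
Qed.

Lemma le_eball x (r s : R) : r <= s -> eball x r `<=` eball x s.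
Proof. by move=> rs; apply: eball_sub; rewrite vdistxx add0r. Qed.

Lemma measurable_coord i : measurable_fun [set: V] (fun x => tnth x i : R).
Proof. exact: measurable_tnth. Qed.

Lemma measurable_vdist x : measurable_fun [set: V] (vdist x).
Proof.
apply: (measurableT_comp (continuous_measurable_fun (@sqrt_continuous R))).
apply: measurable_sum => i; apply: measurable_funX.
by apply: measurable_funB => //; exact: measurable_coord.
Qed.

Lemma measurable_eball x (r : R) : measurable (eball x r).
Proof.
have := @measurable_vdist x measurableT `]-oo, r[%classic (measurable_itv _).
by rewrite setTI; congr measurable; apply/seteqP; split=> y /=; rewrite in_itv.
Qed.

Lemma measurable_hspace : measurable (@hspace R n).
Proof.
have := @measurable_coord ord_max measurableT `]0, +oo[%classic (measurable_itv _).
rewrite setTI; congr measurable; apply/seteqP; split=> y /=;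
  by rewrite in_itv/= andbT.
Qed.

Lemma measurable_hball x (r : R) : measurable (hball x r).
Proof. by apply: measurableI; [exact: measurable_eball|exact: measurable_hspace]. Qed.

(** Volumes of balls enter only through inscribed and circumscribed cubes, so dimensional constants
    suffice and the volume of the unit ball is never computed. *)
Let cube x (r : R) : set V :=
  [set y | forall i, `](tnth x i : R) - r, (tnth x i : R) + r[%classic (tnth y i)].

Let mu_cube x (r : R) : 0 < r -> mu (cube x r) = ((2 * r) ^+ n.+1)%:E.
Proof.
move=> r0; have := @lebesgue_rvec_box R n.+1
  (fun i => `](tnth x i : R) - r, (tnth x i : R) + r[%classic).
rewrite /cube => ->; last by move=> i; exact: measurable_itv.
rewrite (eq_bigr (fun=> (2 * r)%:E)).
  by rewrite prodEFin prodr_const card_ord.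
move=> i _; rewrite lebesgue_measure_itv /= lte_fin.
rewrite ifT; last by rewrite ltrD2l; lra.
by rewrite -EFinD; congr EFin; ring.
Qed.

Let measurable_cube x (r : R) : measurable (cube x r).
Proof.
exact: (@measurable_rvec_box R n.+1
  (fun i => `](tnth x i : R) - r, (tnth x i : R) + r[%classic)).
Qed.

Lemma lebesgue_eball_le x (r : R) : 0 < r ->
  (mu (eball x r) <= ((2 * r) ^+ n.+1)%:E)%E.
Proof.
move=> r0; rewrite -(mu_cube x)//; apply: le_measure; rewrite ?inE//.
  exact: measurable_eball.
move=> y; rewrite /eball /= => xy i /=; rewrite in_itv/=.
have := le_lt_trans (coord_le_vdist x y i) xy.
by rewrite ltr_norml => /andP[h1 h2]; apply/andP; split; lra.
Qed.

Lemma lebesgue_eball_ge x (r : R) : 0 < r ->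
  (((2 * (r / n.+1%:R)) ^+ n.+1)%:E <= mu (eball x r))%E.
Proof.
move=> r0; have r0' : 0 < r / n.+1%:R by rewrite divr_gt0.
rewrite -(mu_cube x)//.
apply: le_measure; rewrite ?inE//; first exact: measurable_eball.
move=> y xy; rewrite /eball /=; apply: vdist_lt_coord => // i.
have := xy i; rewrite /= in_itv/= ltr_norml; move: (r / _) => e /andP[h1 h2].
by apply/andP; split; lra.
Qed.

Lemma lebesgue_eball_gt0 x (r : R) : 0 < r -> (0 < mu (eball x r))%E.
Proof.
move=> r0; apply: (lt_le_trans _ (lebesgue_eball_ge x r r0)).
by rewrite lte_fin exprn_gt0// mulr_gt0// divr_gt0.
Qed.

Lemma lebesgue_eball_fin x (r : R) : 0 < r -> mu (eball x r) \is a fin_num.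
Proof.
move=> r0; rewrite ge0_fin_numE ?measure_ge0//.
by rewrite (le_lt_trans (lebesgue_eball_le x r r0))// ltry.
Qed.

(** Only the last coordinate matters, and there (-a - b)^2 - (a - b)^2 = 4ab >= 0. The reflected
    kernel is thus dominated by the unreflected one. *)
Lemma vdist_vrefl x y : hspace x -> hspace y -> vdist x y <= vdist (Defs.vrefl x) y.
Proof.
rewrite /hspace /= => x0 y0.
rewrite -(@ler_pXn2r _ 2)// ?nnegrE ?vdist_ge0// !vdist_sqr.
apply: ler_sum => i _; rewrite /Defs.vrefl tnth_mktuple.
case: eqVneq => [->|//].
rewrite -subr_ge0.
have -> : (- (tnth x ord_max : R) - tnth y ord_max) ^+ 2 - ((tnth x ord_max : R) - tnth y ord_max) ^+ 2
  = 4 * ((tnth x ord_max : R) * tnth y ord_max) by ring.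
by rewrite mulr_ge0// mulr_ge0// ltW.
Qed.

(** The centre c is x raised by r/2 in the last coordinate, so the ball of radius r/2 about c stays
    above the height of x. Combined with doubling, this makes the weights of a ball and of its
    half-ball comparable. *)
Lemma half_ball x (r : R) : hspace x -> 0 < r ->
  exists c, eball c (r / 2) `<=` hball x r /\ eball x r `<=` eball c (2 * r).
Proof.
rewrite /hspace /= => x0 r0.
pose c : V := [tuple if i == ord_max then (tnth x i : R) + r / 2 else tnth x i | i < n.+1].
have dcx : vdist c x = r / 2.
  apply/eqP; rewrite -(@eqrXn2 _ 2)// ?vdist_ge0 ?divr_ge0 ?(ltW r0)//.
  rewrite vdist_sqr (bigD1 ord_max)//= big1 ?addr0.
    by rewrite tnth_mktuple eqxx; apply/eqP; ring.
  by move=> i /negbTE ni; rewrite tnth_mktuple ni subrr expr0n.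
exists c; split; last by apply: eball_sub; rewrite dcx; lra.
move=> y cy; split; first by apply: eball_sub cy; rewrite vdistC dcx; lra.
have := le_lt_trans (coord_le_vdist c y ord_max) cy.
rewrite tnth_mktuple eqxx ltr_norml /hspace/= => /andP[h1 h2].
by lra.
Qed.

Lemma continuous_row_of_rvec : continuous (@row_of_rvec R n.+1 : V -> 'rV[R]_n.+1).
Proof. exact: initial_continuous. Qed.

Lemma compact_rvec_bounded (K : set V) x : compact K ->
  exists M : R, 0 < M /\ K `<=` eball x M.
Proof.
move=> cK.
have : compact (@row_of_rvec R n.+1 @` K).
  apply: continuous_compact => //; apply: continuous_subspaceT.
  exact: continuous_row_of_rvec.
move=> /compact_bounded [M0 [_ hM0]].
pose M := `|M0| + 1.
have hM y i : K y -> `|tnth y i : R| <= M.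
  move=> Ky; have M0M : M0 < M by rewrite ltr_pwDr// ler_norm.
  have : `|row_of_rvec y| <= M by apply: (hM0 _ M0M); exists y.
  apply: le_trans; rewrite /Num.norm/= mx_normrE.
  have -> : (tnth y i : R) = row_of_rvec y ord0 i by rewrite mxE.
  by rewrite -[leLHS]/((fun ij => `|row_of_rvec y ij.1 ij.2|) (ord0, i)); exact: le_bigmax.
pose B := M + 1 + \sum_i `|tnth x i : R|.
have S0 : 0 <= \sum_i `|tnth x i : R| by apply: sumr_ge0.
have B0 : 0 < B by rewrite /B /M; have := normr_ge0 M0; lra.
exists (B * n.+1%:R); split; first by rewrite mulr_gt0.
move=> y Ky; apply: vdist_lt_coord => [|i]; first by rewrite mulr_gt0.
rewrite mulfK ?pnatr_eq0// (le_lt_trans (ler_normB _ _))//.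
have : `|tnth x i : R| <= \sum_i `|tnth x i : R|.
  by rewrite (bigD1 i)//= lerDl sumr_ge0.
by have := hM y i Ky; rewrite /B; lra.
Qed.

(* The boxes [-k, k]^(n-1) x [1/(k+1), k] exhaust the half-space by compact sets. *)
Definition exhaust_side (k : nat) (i : 'I_n.+1) : interval R :=
  if i == ord_max then `[k.+1%:R^-1, k%:R] else `[- k%:R, k%:R].

Definition exhaust (k : nat) : set V :=
  [set y | forall i, [set` exhaust_side k i] (tnth y i : R)].

(** The box is the image of a product of segments under the inverse of [row_of_rvec], which is
    continuous because the topology of V is initial for that map. *)
Lemma compact_exhaust k : compact (exhaust k).
Proof.
pose A i := [set` exhaust_side k i].
have cA : compact [set v : 'rV[R]_n.+1 | forall i, A i (v ord0 i)].
  by apply: rV_compact => i; rewrite /A /exhaust_side; case: ifP => _; exact: segment_compact.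
pose g (v : 'rV[R]_n.+1) : V := [tuple v ord0 i | i < n.+1].
have gc : continuous (g : 'rV[R]_n.+1 -> V).
  apply: (@continuous_comp_initial _ _ _ (@row_of_rvec R n.+1)).
  have -> : @row_of_rvec R n.+1 \o g = id.
    by apply/funext => v; apply/rowP => i; rewrite /= mxE tnth_mktuple.
  by move=> v; exact: cvg_id.
have -> : exhaust k = g @` [set v : 'rV[R]_n.+1 | forall i, A i (v ord0 i)].
  apply/seteqP; split => [y hy|_ [v hv <-] i].
    exists (row_of_rvec y).
      by move=> i; rewrite mxE; exact: hy.
    by apply/eq_from_tnth => i; rewrite tnth_mktuple mxE.
  by rewrite tnth_mktuple; exact: hv.
by apply: continuous_compact => //; apply: continuous_subspaceT.
Qed.

Lemma exhaust_hspace k : exhaust k `<=` @hspace R n.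
Proof.
move=> y /(_ ord_max); rewrite /exhaust_side eqxx /= in_itv/= /hspace/= => /andP[h _].
by apply: lt_le_trans h; rewrite invr_gt0.
Qed.

Lemma measurable_exhaust k : measurable (exhaust k).
Proof.
apply: (@measurable_rvec_box R n.+1 (fun i => [set` exhaust_side k i])) => i.
exact: measurable_itv.
Qed.

Lemma near_exhaust y : hspace y -> \forall k \near \oo, exhaust k y.
Proof.
rewrite /hspace/= => y0.
(* The inverse handles the lower side 1/(k+1) of the last coordinate, the sum all the other
   sides. *)
pose M := (tnth y ord_max : R)^-1 + \sum_i `|tnth y i : R|.
near=> k.
have kM : M <= k%:R by near: k; exact: nbhs_infty_ger.
have yM i : `|tnth y i : R| <= k%:R.
  apply: le_trans kM; rewrite /M (bigD1 i)//= addrCA lerDl.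
  by rewrite addr_ge0 ?sumr_ge0// invr_ge0 ltW.
move=> i; have := yM i; rewrite /exhaust_side; case: eqVneq => [->|_] /=; rewrite in_itv/= ler_norml.
  move=> /andP[_ ->]; rewrite andbT -[leRHS]invrK lef_pV2 ?posrE ?invr_gt0//.
  apply: (@le_trans _ _ k%:R); last by rewrite ler_nat.
  by apply: le_trans kM; rewrite lerDl sumr_ge0.
by move=> /andP[-> ->].
Unshelve. all: by end_near. Qed.

Lemma near_eball x y : \forall k \near \oo, eball x k%:R y.
Proof.
near=> k; rewrite /eball/=; near: k.
have [m hm] := nbhs_infty_gtr (vdist x y).
by exists m.
Unshelve. all: by end_near. Qed.

End geometry.

(** * Muckenhoupt weights *)

Section muckenhoupt.
Context {R : realType} {n : nat}.
Local Notation V := (rvec R n.+1).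
Local Notation mu := (lebesgue_rvec R n.+1).
Context {p : R} {w : V -> R} (p1 : 1 < p) (hw : Muckenhoupt p w).
Implicit Types (x y c : V) (r : R).
Local Open Scope ereal_scope.

Local Notation Ap := (Ap_const p w).
Local Notation dual E := (\int[mu]_(x in E) ((w x)%:E `^ (p - 1)^-1)^-1).

Let p0 : (0 < p)%R. Proof. exact: lt_trans p1. Qed.
Let pm0 : (0 < p - 1)%R. Proof. by rewrite subr_gt0. Qed.
Let mw : measurable_fun setT w. Proof. by case: hw => -[]. Qed.
Let w0 x : (0 <= w x)%R. Proof. by case: hw => -[]. Qed.
Let Ap_fin : Ap < +oo. Proof. by case: hw. Qed.

Lemma wmeas_ge0 E : 0 <= wmeas w E.
Proof. by apply: integral_ge0 => x _; rewrite lee_fin. Qed.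

Let dual_ge0 E : 0 <= dual E.
Proof. by apply: integral_ge0 => x _; rewrite inve_ge0 poweR_ge0. Qed.

Lemma le_wmeas (E F : set V) : measurable E -> measurable F -> E `<=` F ->
  wmeas w E <= wmeas w F.
Proof.
move=> mE mF EF; apply: ge0_subset_integral => //.
  by apply/measurable_EFinP; exact: measurable_funTS.
by move=> x _; rewrite lee_fin.
Qed.

Let le_dual (E F : set V) : E `<=` F -> dual E <= dual F.
Proof.
move=> EF; rewrite [leLHS]integral_mkcond [leRHS]integral_mkcond.
apply: ge0_le_integral_dom => x _; rewrite /patch; case: ifPn => //.
- by move=> _; rewrite inve_ge0 poweR_ge0.
- by move=> /set_mem /EF /mem_set ->.
- by move=> _; case: ifP => // _; rewrite inve_ge0 poweR_ge0.
Qed.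

Lemma Ap_const_ge0 : 0 <= Ap.
Proof.
pose x0 : V := [tuple 0%R | i < n.+1].
apply: (@le_trans _ _ ((mu (eball x0 1))^-1 * wmeas w (eball x0 1) *
      ((mu (eball x0 1))^-1 * dual (eball x0 1)) `^ (p - 1))).
  by rewrite mule_ge0 ?poweR_ge0// mule_ge0 ?wmeas_ge0// inve_ge0.
by apply: ereal_sup_ubound; exists (x0, 1%R) => //=; exact: ltr01.
Qed.

(** The two averages contribute |B|^-1 |B|^-(p-1) = |B|^-p, which can be moved across since 0 < |B|
    < +oo. *)
Let Ap_ball x r : (0 < r)%R ->
  wmeas w (eball x r) * dual (eball x r) `^ (p - 1) <=
  Ap * mu (eball x r) `^ p.
Proof.
move=> r0.
have : (mu (eball x r))^-1 * wmeas w (eball x r) *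
      ((mu (eball x r))^-1 * dual (eball x r)) `^ (p - 1) <= Ap.
  by apply: ereal_sup_ubound; exists (x, r).
have mf := lebesgue_eball_fin x r r0; have mp := lebesgue_eball_gt0 x r r0.
set m := mu (eball x r) in mf mp *.
move: mp; rewrite -(fineK mf) lte_fin; move: (fine m) => {mf}m m0.
rewrite inver gt_eqF// poweRM ?lee_fin ?invr_ge0 ?(ltW m0)//.
rewrite !poweR_EFin muleACA -EFinM.
have -> : (m^-1 * m^-1 `^ (p - 1) = (m `^ p)^-1)%R.
  rewrite -{1}[m^-1%R]powRr1 ?invr_ge0 ?(ltW m0)// -powRD; last first.
    by rewrite invr_eq0 (gt_eqF m0) implybT.
  by rewrite addrC subrK -!powR_inv1 ?powR_ge0 ?(ltW m0)// powRAC.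
by rewrite muleC lee_pdivrMr// powR_gt0.
Qed.

Section positive.
Context (wpos : {ae mu, forall x, (0 < w x)%R}).

Let hoelder_ball (E : set V) (g : V -> R) x r : (0 < r)%R -> measurable E ->
  E `<=` eball x r -> measurable_fun E g ->
  (\int[mu]_(y in E) `|g y|%:E) `^ p <=
  \int[mu]_(y in E) (`|g y| `^ p * w y)%:E * dual (eball x r) `^ (p - 1).
Proof.
move=> r0 mE EB mg; apply: le_trans.
  apply: (@weighted_hoelder _ _ _ mu E g w p) => //.
    exact: measurable_funTS.
  by apply: filterS wpos.
apply: lee_wpmul2l.
  by apply: integral_ge0 => y _; rewrite lee_fin mulr_ge0 ?powR_ge0.
by apply: gt0_ler_poweR; rewrite ?(ltW pm0) ?in_itv/= ?dual_ge0 ?leey// le_dual.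
Qed.

(** Hölder with g = 1 bounds the product of the two quantities below by |B|^p > 0, so neither
    vanishes. Since [Ap_ball] bounds the same product above, each of them is then finite as well. *)
Let wmeas_dual_gt0 x r : (0 < r)%R ->
  0 < wmeas w (eball x r) /\ 0 < dual (eball x r) `^ (p - 1).
Proof.
move=> r0.
have := hoelder_ball (eball x r) (cst 1%R) x r r0 (measurable_eball x r) (@subset_refl _ _).
move=> /(_ (measurable_cst _)).
under eq_integral do rewrite normr1.
rewrite integral_cst ?mul1e; last exact: measurable_eball.
under eq_integral do rewrite normr1 powR1 mul1r.
rewrite -/(wmeas w _) => h.
have : 0 < wmeas w (eball x r) * dual (eball x r) `^ (p - 1).
  by apply: lt_le_trans h; rewrite poweR_gt0// lebesgue_eball_gt0.
have := wmeas_ge0 (eball x r); rewrite le_eqVlt => /orP[/eqP<-|W]; first by rewrite mul0e ltxx.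
have := poweR_ge0 (dual (eball x r)) (p - 1); rewrite le_eqVlt => /orP[/eqP<-|D].
  by rewrite mule0 ltxx.
by [].
Qed.

Lemma wmeas_eball_gt0 x r : (0 < r)%R -> 0 < wmeas w (eball x r).
Proof. by move=> /(wmeas_dual_gt0 x) []. Qed.

Let Ap_mu_lty x r : (0 < r)%R -> Ap * mu (eball x r) `^ p < +oo.
Proof.
move=> r0; have := lebesgue_eball_fin x r r0.
move=> mf; rewrite lte_mul_pinfty ?Ap_const_ge0 ?poweR_lty//.
  by rewrite ge0_fin_numE ?Ap_const_ge0.
by rewrite -ge0_fin_numE.
Qed.

Lemma wmeas_eball_fin x r : (0 < r)%R -> wmeas w (eball x r) \is a fin_num.
Proof.
move=> r0; rewrite ge0_fin_numE ?wmeas_ge0//.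
have [W D] := wmeas_dual_gt0 x r r0.
rewrite ltNge leye_eq; apply/negP => /eqP Woo.
have := le_lt_trans (Ap_ball x r r0) (Ap_mu_lty x r r0).
by rewrite Woo gt0_mulye// ltxx.
Qed.

Let dual_fin x r : (0 < r)%R -> dual (eball x r) `^ (p - 1) \is a fin_num.
Proof.
move=> r0; rewrite ge0_fin_numE ?poweR_ge0//.
have [W D] := wmeas_dual_gt0 x r r0.
rewrite ltNge leye_eq; apply/negP => /eqP Woo.
have := le_lt_trans (Ap_ball x r r0) (Ap_mu_lty x r r0).
by rewrite Woo gt0_muley// ltxx.
Qed.

(** Multiplying Hölder's inequality by w(B) creates the A_p product, which absorbs the dual
    integral. The choice g = 1 gives doubling, the choice g = f the L_1 bounds on dyadic balls. *)
Lemma Ap_hoelder (E : set V) (g : V -> R) x r : (0 < r)%R -> measurable E ->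
  E `<=` eball x r -> measurable_fun E g ->
  wmeas w (eball x r) * (\int[mu]_(y in E) `|g y|%:E) `^ p <=
  Ap * mu (eball x r) `^ p * \int[mu]_(y in E) (`|g y| `^ p * w y)%:E.
Proof.
move=> r0 mE EB mg.
apply: le_trans (lee_wpmul2r _ (Ap_ball x r r0)); last first.
  by apply: integral_ge0 => y _; rewrite lee_fin mulr_ge0 ?powR_ge0.
rewrite -muleA; apply: lee_wpmul2l; first exact: wmeas_ge0.
by rewrite muleC; exact: hoelder_ball.
Qed.

(** Apply [Ap_hoelder] to the constant 1 on the small ball inside the large one. The centres may
    differ, and the ratio 4 is exactly what [half_ball] calls for: radii r/2 and 2r. *)
Lemma doubling : exists K : R, (0 <= K)%R /\ forall x y r, (0 < r)%R ->
  eball y r `<=` eball x (4 * r) ->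
  wmeas w (eball x (4 * r)) <= K%:E * wmeas w (eball y r).
Proof.
(* The base is the volume of the cube around the large ball, of side 8r, over that of the cube
   inside the small ball, of side 2r/(n+1). *)
pose c : R := (((4 * n.+1%:R) ^+ n.+1) `^ p)%R.
exists (fine Ap * c)%R; split.
  by rewrite mulr_ge0 ?powR_ge0// fine_ge0// Ap_const_ge0.
move=> x y r r0 yx.
have r40 : (0 < 4 * r)%R by rewrite mulr_gt0.
have := Ap_hoelder (eball y r) (cst 1%R) x (4 * r) r40 (measurable_eball y r) yx.
move=> /(_ (measurable_cst _)).
under eq_integral do rewrite normr1.
rewrite integral_cst ?mul1e; last exact: measurable_eball.
under eq_integral do rewrite normr1 powR1 mul1r.
rewrite -/(wmeas w _).
have Af : Ap \is a fin_num by rewrite ge0_fin_numE ?Ap_const_ge0.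
have my : 0 < mu (eball y r) `^ p by rewrite poweR_gt0// lebesgue_eball_gt0.
have myf : mu (eball y r) `^ p \is a fin_num.
  by rewrite fin_num_poweR// lebesgue_eball_fin.
have mxy : mu (eball x (4 * r)) `^ p <= c%:E * mu (eball y r) `^ p.
  rewrite /c -poweR_EFin -poweRM; last 2 first.
  - by rewrite lee_fin exprn_ge0// mulr_ge0.
  - exact: measure_ge0.
  apply: gt0_ler_poweR; rewrite ?(ltW p0) ?in_itv/= ?leey ?measure_ge0//.
    by rewrite andbT mule_ge0// lee_fin exprn_ge0// mulr_ge0.
  apply: (le_trans (lebesgue_eball_le x (4 * r) r40)).
  apply: (@le_trans _ _ (((4 * n.+1%:R) ^+ n.+1)%R%:E * ((2 * (r / n.+1%:R)) ^+ n.+1)%:E)).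
    rewrite -EFinM lee_fin -exprMn le_eqVlt; apply/orP; left; apply/eqP.
    by congr (_ ^+ _)%R; field.
  apply: lee_wpmul2l; last exact: lebesgue_eball_ge.
  by rewrite lee_fin exprn_ge0// mulr_ge0.
move=> h; rewrite -(@lee_pmul2r _ (mu (eball y r) `^ p))//.
apply: (le_trans h).
rewrite EFinM fineK// -!muleA; apply: lee_wpmul2l; first exact: Ap_const_ge0.
by rewrite [leRHS]muleCA [leRHS]muleC; apply: lee_wpmul2r => //; exact: wmeas_ge0.
Qed.

End positive.

(* If w vanishes on a set of positive measure, the dual average is infinite on
   every large ball, and the A_p constant is finite only because 0 * +oo = 0. *)
Lemma weight_dichotomy :
  {ae mu, forall x, (0 < w x)%R} \/ {ae mu, forall x, w x = 0%R}.
Proof.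
pose Z : set V := w @^-1` [set 0%R].
have mZ : measurable Z by rewrite -[Z]setTI; exact: mw.
have [Z0|Zn0] := eqVneq (mu Z) 0.
  left; exists Z; split => // x /=; apply: contra_notP => Zx.
  by rewrite lt0r w0 andbT; apply/eqP.
right.
pose x0 : V := [tuple 0%R | i < n.+1].
pose B k := eball x0 k%:R.
have mB k : measurable (B k) by exact: measurable_eball.
have : exists k, mu (Z `&` B k) != 0.
  apply: contrapT => /forallNP h; move/eqP: Zn0; apply.
  have -> : Z = \bigcup_k (Z `&` B k).
    apply/seteqP; split => [x Zx|x [k _ []]//].
    by have [m _ hm] := near_eball x0 x; exists m => //; split => //; apply: hm => /=.
  apply/negligibleP; first by apply: bigcup_measurable => k _; exact: measurableI.
  apply: negligible_bigcup => k; apply/negligibleP; first exact: measurableI.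
  by apply/eqP/negPn/negP; exact: h.
move=> [k0 hk0].
(* The shift to [k0.+1] guarantees a positive radius. *)
have Woo k : (k0.+1 <= k)%N -> wmeas w (B k) = 0.
  move=> k0k; have k_gt0 : (0 < k%:R :> R)%R by rewrite ltr0n (leq_trans _ k0k).
  have Doo : dual (B k) = +oo.
    apply/eqP; rewrite -leye_eq.
    apply: (@le_trans _ _ (\int[mu]_(x in Z `&` B k0) (cst +oo x))).
      rewrite integral_cst; last exact: measurableI.
      by rewrite gt0_mulye// lt0e hk0 measure_ge0.
    apply: (@le_trans _ _ (dual (Z `&` B k0))); last first.
      by apply: le_dual => x [_]; apply: le_eball; rewrite ler_nat ltnW.
    apply: ge0_le_integral_dom => [x _|x [Zx _]] /=; first exact: leey.
    by rewrite (_ : w x = 0%R)// powR0 ?inve0// invr_eq0 gt_eqF.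
  (* If w(B) were positive, its product with the infinite dual factor would be +oo, against the
     finite bound of [Ap_ball]. *)
  apply/eqP/negPn/negP => W0.
  have := Ap_ball x0 k%:R k_gt0.
  rewrite -/(B k) Doo poweRyr ?gt_eqF// gt0_muley; last by rewrite lt0e W0 wmeas_ge0.
  rewrite leye_eq => /eqP h.
  have mf := lebesgue_eball_fin x0 k%:R k_gt0.
  have : Ap * mu (B k) `^ p < +oo.
    rewrite lte_mul_pinfty ?Ap_const_ge0 ?poweR_lty//.
      by rewrite ge0_fin_numE ?Ap_const_ge0.
    by rewrite -ge0_fin_numE.
  by rewrite h ltxx.
have aeB k : {ae mu, forall x, B (k0.+1 + k)%N x -> w x = 0%R}.
  have : ae_eq mu (B (k0.+1 + k)%N) (EFin \o w) (cst 0).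
    apply/(ae_eq_integral_abs mu (mB _)).
      by apply/measurable_EFinP; exact: measurable_funTS.
    rewrite -[RHS](Woo (k0.+1 + k)%N (leq_addr _ _)).
    by apply: eq_integral => x _; rewrite /= ger0_norm.
  apply: filterS => x h Bx; have := h Bx; by case.
have : {ae mu, forall x k, B (k0.+1 + k)%N x -> w x = 0%R} by exact: ae_foralln.
apply: filterS => x h.
have [m _ hm] := near_eball x0 x.
by apply: (h m); apply: hm; rewrite /= leq_addl.
Qed.

End muckenhoupt.

(** * Dyadic sums *)

Section dyadic_sums.
Context {R : realType} {n : nat} {p : R} {w : rvec R n.+1 -> R}
  (p1 : 1 < p) (hw : Muckenhoupt p w)
  (wpos : {ae lebesgue_rvec R n.+1, forall x, 0 < w x}).
Local Notation V := (rvec R n.+1).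
Local Notation mu := (lebesgue_rvec R n.+1).
Implicit Types (x y c : V) (r s t : R) (f g : V -> R).

Local Notation W x r := (fine (wmeas w (eball x r))).
Local Notation N f E := (\int[mu]_(y in E) (`|f y| `^ p * w y)%:E)%E.

Let p0 : 0 < p. Proof. exact: lt_trans p1. Qed.
Let mw : measurable_fun setT w. Proof. by case: hw => -[]. Qed.
Let w0 x : 0 <= w x. Proof. by case: hw => -[]. Qed.

Lemma Lp_integral_ge0 f E : (0 <= N f E)%E.
Proof. by apply: integral_ge0 => y _; rewrite lee_fin mulr_ge0 ?powR_ge0. Qed.

Lemma measurable_Lp_integrand f E : measurable E -> measurable_fun E f ->
  measurable_fun E (fun y => (`|f y| `^ p * w y)%:E).
Proof.
move=> mE mf; apply/measurable_EFinP; apply: measurable_funM; last exact: measurable_funTS.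
apply: (measurableT_comp (measurable_powR _)).
exact: (measurableT_comp (@normr_measurable _ setT)).
Qed.

Lemma le_Lp_integral f E F : measurable E -> measurable F -> measurable_fun F f ->
  E `<=` F -> (N f E <= N f F)%E.
Proof.
move=> mE mF mf EF; apply: ge0_subset_integral => //.
  exact: measurable_Lp_integrand.
by move=> x _; rewrite lee_fin mulr_ge0 ?powR_ge0.
Qed.

Lemma wmeas_eballE x r : 0 < r -> wmeas w (eball x r) = (W x r)%:E.
Proof. by move=> r0; rewrite fineK// (wmeas_eball_fin p1 hw wpos). Qed.

Lemma fine_wmeas_gt0 x r : 0 < r -> 0 < W x r.
Proof.
by move=> r0; rewrite -lte_fin -wmeas_eballE// (wmeas_eball_gt0 p1 hw wpos).
Qed.

Lemma wmeas_doubling : exists K : R, 0 < K /\ forall x y r, 0 < r ->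
  eball y r `<=` eball x (4 * r) -> W x (4 * r) <= K * W y r.
Proof.
have [K [K0 hK]] := doubling p1 hw wpos.
exists (K + 1); split; first by lra.
move=> x y r r0 yx; have := hK x y r r0 yx.
rewrite (wmeas_eballE x (4 * r)) ?mulr_gt0// (wmeas_eballE y r)//.
rewrite -EFinM lee_fin => /le_trans; apply.
by rewrite mulrDl mul1r lerDl ltW// fine_wmeas_gt0.
Qed.

Lemma wmeas_double_radius : exists K : R, 0 < K /\ forall x r, 0 < r ->
  W x (2 * r) <= K * W x r.
Proof.
have [K [K0 hK]] := wmeas_doubling; exists K; split => // x r r0.
apply: (@le_trans _ _ (W x (4 * r))); last first.
  by apply: hK => //; apply: le_eball; lra.
rewrite -lee_fin -!wmeas_eballE ?mulr_gt0//.
apply: (le_wmeas hw); [exact: measurable_eball..|].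
by apply: le_eball; lra.
Qed.

(** The ball lies in B(c, 2r), whose weight doubling compares with that of B(c, r/2), a subset of
    the half-ball. *)
Lemma wmeas_hball : exists K : R, 0 < K /\ forall x r, hspace x -> 0 < r ->
  ((W x r)%:E <= K%:E * wmeas w (hball x r))%E.
Proof.
have [K [K0 hK]] := wmeas_doubling; exists K; split => // x r hx r0.
have [c [cx xc]] := half_ball x r hx r0.
have r20 : 0 < r / 2 by rewrite divr_gt0.
have r4 : 2 * r = 4 * (r / 2) by field.
apply: (@le_trans _ _ (W c (2 * r))%:E).
  rewrite -!wmeas_eballE ?mulr_gt0//.
  by apply: (le_wmeas hw) => //; exact: measurable_eball.
apply: (@le_trans _ _ (K * W c (r / 2))%:E).
  by rewrite lee_fin r4; apply: hK => //; apply: le_eball; lra.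
rewrite EFinM lee_pmul2l// -wmeas_eballE//.
by apply: (le_wmeas hw) => //; [exact: measurable_eball|exact: measurable_hball].
Qed.

Lemma wmeas_hball_gt0 x r : hspace x -> 0 < r -> (0 < wmeas w (hball x r))%E.
Proof.
move=> hx r0; have [K [K0 hK]] := wmeas_hball.
rewrite lt0e (wmeas_ge0 hw) andbT; apply/eqP => h.
have := hK x r hx r0; rewrite h mule0 lee_fin.
by rewrite leNgt fine_wmeas_gt0.
Qed.

Lemma wmeas_hball_le x r : (wmeas w (hball x r) <= wmeas w (eball x r))%E.
Proof.
apply: (le_wmeas hw) => //; [exact: measurable_hball|exact: measurable_eball|].
exact: subIsetl.
Qed.

Lemma wmeas_hball_fin x r : 0 < r -> wmeas w (hball x r) \is a fin_num.
Proof.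
move=> r0; rewrite ge0_fin_numE ?(wmeas_ge0 hw)//.
by rewrite (le_lt_trans (wmeas_hball_le x r))// wmeas_eballE// ltry.
Qed.

Section morrey_function.
Context {phi1 : V -> R -> R} (phi1_gt0 : forall x r, hspace x -> 0 < r -> 0 < phi1 x r)
  {f : V -> R} (mf : measurable_fun (@hspace R n) f) {M : R} (M0 : 0 < M)
  (fM : (morrey_norm p phi1 w f <= M%:E)%E).

(** The Morrey norm divides by w(B^+), whereas the condition on (phi1, phi2) is written with w(B);
    w(B^+) <= w(B) allows the exchange. *)
Lemma morrey_ball x r : hspace x -> 0 < r ->
  (N f (hball x r) `^ p^-1 <= (M * phi1 x r)%:E * (wmeas w (eball x r)) `^ p^-1)%E.
Proof.
move=> hx r0.
have : ((phi1 x r)^-1%:E * ((wmeas w (hball x r))^-1 * N f (hball x r)) `^ p^-1 <= M%:E)%E.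
  by apply: le_trans fM; apply: ereal_sup_ubound; exists (x, r).
have ph := phi1_gt0 x r hx r0.
have Wf := wmeas_hball_fin x r r0.
have Wg := wmeas_hball_gt0 x r hx r0.
have WW := wmeas_hball_le x r.
have pV0 : 0 <= p^-1 by rewrite invr_ge0 ltW.
have {}WW : (wmeas w (hball x r) `^ p^-1 <= wmeas w (eball x r) `^ p^-1)%E.
  by apply: gt0_ler_poweR => //; rewrite in_itv/= leey andbT (wmeas_ge0 hw).
have MP : (0 <= (M * phi1 x r)%:E)%E by rewrite lee_fin ltW// mulr_gt0.
move=> h; apply: le_trans (lee_wpmul2l MP WW).
move: Wf Wg h; case: (wmeas w (hball x r)) => // W _; rewrite lte_fin => W0.
rewrite inver gt_eqF// poweRM ?lee_fin ?invr_ge0 ?(ltW W0) ?Lp_integral_ge0//.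
rewrite !poweR_EFin -(powR_inv1 (ltW W0)) powRAC (powR_inv1 (powR_ge0 W _)).
have u0 : 0 < W `^ p^-1 by rewrite powR_gt0.
move: (W `^ _) u0 => u u0; rewrite muleA -EFinM.
rewrite muleC -lee_pdivlMr; last by rewrite mulr_gt0 ?invr_gt0.
move=> /le_trans; apply.
rewrite -!EFinM lee_fin le_eqVlt; apply/orP; left; apply/eqP.
by field; rewrite !gt_eqF.
Qed.

Lemma morrey_ball_fin x r : hspace x -> 0 < r -> N f (hball x r) \is a fin_num.
Proof.
move=> hx r0; have := morrey_ball x r hx r0.
rewrite wmeas_eballE// poweR_EFin -EFinM.
rewrite ge0_fin_numE ?Lp_integral_ge0//.
have := Lp_integral_ge0 f (hball x r).
case: (N f (hball x r)) => [a||]//; first by rewrite ltry.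
by rewrite poweRyr// invr_eq0 gt_eqF.
Qed.

Local Notation rad r k := (2 ^+ k * r).
Local Notation F x r := (fine (N f (hball x r))).

(** For t in the dyadic interval [I k], the integrand of the condition is at least the constant
    [a k]: the essential infimum is bounded below through the radius at the left end, w(B_t) and t
    are bounded above by their values at the right end. This is why W carries the index [k.+1]. The
    factor 2 is the ratio of the right end to the length of [I k], and M comes from
    [morrey_ball]. *)
Lemma pair_sum (phi2 : V -> R -> R) (C1 : R) x r m : hspace x -> 0 < r ->
  weight_pair_condition p w phi1 phi2 C1 ->
  \sum_(k < m) F x (rad r k) `^ p^-1 / W x (rad r k.+1) `^ p^-1 <=
  2 * M * (C1 * phi2 x r).
Proof.
move=> hx r0 hC.
have rad0 k : 0 < rad r k by rewrite mulr_gt0// exprn_gt0.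
have radS k : rad r k.+1 = 2 * rad r k by rewrite exprS mulrA.
have rad_le j k : (j <= k)%N -> rad r j <= rad r k.
  by move=> jk; rewrite ler_pM2r// ler_eXn2l// ltr1n.
have real_bound (A b u v t s : R) : 0 <= A -> 0 < b -> 0 < u -> u <= v -> 0 < t ->
    t <= s -> A / b / v / s <= A / b / u / t.
  move=> A0 m0 u0 uv t0 ts.
  have v0 : 0 < v by exact: lt_le_trans uv.
  have s0 : 0 < s by exact: lt_le_trans ts.
  have Am : 0 <= A / b by rewrite divr_ge0// ltW.
  apply: ler_pM; [by rewrite divr_ge0// ltW|by rewrite invr_ge0 ltW| |].
    by apply: ler_wpM2l => //; rewrite lef_pV2.
  by rewrite lef_pV2.
pose a k := F x (rad r k) `^ p^-1 / M / W x (rad r k.+1) `^ p^-1 / rad r k.+1.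
have a0 k : 0 <= a k.
  by rewrite /a !divr_ge0 ?powR_ge0 ?(ltW M0) ?(ltW (rad0 _)).
pose I k : set R := `]rad r k, rad r k.+1[%classic.
pose h (t : R) : \bar R := (\sum_(k < m) (a k)%:E * (\1_(I k) t)%:E)%E.
pose H t := (ess_inf_gt t (fun s => (phi1 x s)%:E * wmeas w (eball x s) `^ p^-1)
       / wmeas w (eball x t) `^ p^-1 * t^-1%:E)%E.
have hH t : `]r, +oo[%classic t -> (h t <= H t)%E.
  rewrite /= in_itv/= andbT => rt.
  have t0 : 0 < t by exact: lt_trans rt.
  have Wt := fine_wmeas_gt0 x t t0.
  have EI k : rad r k < t -> ((F x (rad r k) `^ p^-1 / M)%:E <=
      ess_inf_gt t (fun s => (phi1 x s)%:E * wmeas w (eball x s) `^ p^-1))%E.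
    move=> kt; apply/ess_sup_inf.ess_infP.
    (* The lower bound holds at every s > t; all other s form a null set for the measure restricted
       to that half-line. *)
    exists (~` `]t, +oo[%classic); split.
    - by apply: measurableC; exact: measurable_itv.
    - suff : (@lebesgue_measure R (~` `]t, +oo[ `&` `]t, +oo[) = 0)%E by [].
      by rewrite setICl measure0.
    move=> s /=; apply: contra_not; rewrite in_itv/= andbT => ts.
    have s0 : 0 < s by exact: lt_trans ts.
    have ks : rad r k <= s by rewrite ltW// (lt_trans kt).
    have := morrey_ball x s hx s0.
    rewrite wmeas_eballE// poweR_EFin -!EFinM.
    rewrite -(fineK (morrey_ball_fin x s hx s0)) poweR_EFin !lee_fin => h1.
    rewrite ler_pdivrMr// [leRHS]mulrC mulrA; apply: le_trans h1.
    apply: ge0_ler_powR; rewrite ?nnegrE ?invr_ge0 ?(ltW p0) ?fine_ge0 ?Lp_integral_ge0//.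
    apply: fine_le; rewrite ?morrey_ball_fin//.
    apply: le_Lp_integral; [exact: measurable_hball..| |].
      by apply: measurable_funS mf; [exact: measurable_hspace|exact: subIsetr].
    by apply: setSI; exact: le_eball.
  (* Needed for those t that lie in none of the m intervals, where [h t] is 0. *)
  have H0 : (0 <= H t)%E.
    apply: mule_ge0; last by rewrite lee_fin invr_ge0 ltW.
    apply: mule_ge0; last by rewrite inve_ge0 poweR_ge0.
    apply: le_trans (EI 0 _); last by rewrite expr0 mul1r.
    by rewrite lee_fin mulr_ge0 ?powR_ge0// invr_ge0 ltW.
  have [[k Ik]|/forallNP noI] := pselect (exists k : 'I_m, I k t); last first.
    rewrite /h big1// => k _; rewrite indicE memNset ?mule0//; exact: noI.
  rewrite /h (bigD1 k)//= big1 ?adde0; last first.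
    move=> j jk; rewrite indicE memNset ?mule0// => Ij; move: Ij Ik.
    rewrite /I /= !in_itv/= => /andP[j1 j2] /andP[k1 k2].
    move: jk; rewrite neq_ltn => /orP[jk|kj].
      have := rad_le j.+1 k jk; lra.
    have := rad_le k.+1 j kj; lra.
  rewrite indicE mem_set// mule1.
  move: Ik; rewrite /I /= in_itv/= => /andP[k1 k2].
  apply: (@le_trans _ _ ((F x (rad r k) `^ p^-1 / M)%:E / wmeas w (eball x t) `^ p^-1 * t^-1%:E)%E).
    rewrite wmeas_eballE// poweR_EFin inver gt_eqF ?powR_gt0// -!EFinM lee_fin /a.
    apply: real_bound; [exact: powR_ge0|exact: M0|by rewrite powR_gt0| |exact: t0|exact: ltW].
    apply: ge0_ler_powR; [by rewrite invr_ge0 ltW|exact: ltW|exact/ltW/fine_wmeas_gt0|].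
    rewrite -lee_fin -!wmeas_eballE//.
    apply: (le_wmeas hw); [exact: measurable_eball..|].
    by apply: le_eball; exact: ltW.
  apply: lee_wpmul2r; first by rewrite lee_fin invr_ge0 ltW.
  by apply: lee_wpmul2r; [rewrite inve_ge0 poweR_ge0|exact: EI].
have h0 t : (0 <= h t)%E.
  by apply: sume_ge0 => k _; rewrite mule_ge0 ?lee_fin.
have := le_trans (ge0_le_integral_dom lebesgue_measure _ h H (fun t _ => h0 t) hH)
  (hC x r hx r0).
have mI k : measurable_fun `]r, +oo[%classic (fun t => (\1_(I k) t)%:E : \bar R).
  by apply/measurable_EFinP; apply: measurable_indic; exact: measurable_itv.
rewrite /h ge0_integral_sum; last 3 first.
- exact: measurable_itv.
- by move=> k; apply: emeasurable_funM => //; exact: mI.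
- by move=> k t _; rewrite mule_ge0 ?lee_fin.
have -> : (\sum_(k < m) \int[@lebesgue_measure R]_(t in `]r, +oo[) ((a k)%:E * (\1_(I k) t)%:E) =
    (\sum_(k < m) a k * rad r k)%:E)%E.
  rewrite -sumEFin; apply: eq_bigr => k _.
  rewrite ge0_integralZl; last 4 first.
  - exact: measurable_itv.
  - exact: mI.
  - by move=> t _; rewrite lee_fin.
  - by rewrite lee_fin.
  rewrite integral_indic//; last exact: measurable_itv.
  rewrite (_ : _ `&` _ = I k); last first.
    apply/seteqP; split=> [t []//|t It]; split => //; move: It.
    rewrite /I /= !in_itv/= andbT => /andP[+ _]; apply: le_lt_trans.
    by have := rad_le 0 k isT; rewrite expr0 mul1r.
  rewrite [RHS]EFinM; congr (_ * _)%E.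
  have -> : (rad r k)%:E = @lebesgue_measure R (I k); last by [].
  rewrite /I lebesgue_measure_itv/= lte_fin radS ifT; last by have := rad0 k; lra.
  by rewrite -EFinB; congr EFin; ring.
rewrite lee_fin => hs.
have -> : \sum_(k < m) F x (rad r k) `^ p^-1 / W x (rad r k.+1) `^ p^-1 =
   2 * M * \sum_(k < m) a k * rad r k.
  rewrite mulr_sumr; apply: eq_bigr => k _; rewrite /a radS.
  have := rad0 k; have : 0 < W x (2 * rad r k) `^ p^-1.
    by rewrite powR_gt0// fine_wmeas_gt0// mulr_gt0.
  move: (_ `^ _) => u u0; move: (rad r k) => v v0.
  by field; rewrite !gt_eqF.
by rewrite ler_pM2l// mulr_gt0.
Qed.

End morrey_function.
End dyadic_sums.

(** * The size condition on dyadic annuli *)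

Lemma powRV_le (R : realType) (p a b : R) : 0 < p -> 0 <= a ->
  a `^ p^-1 <= b -> a <= b `^ p.
Proof.
move=> p0 a0 ab; rewrite -[leLHS]powRr1// -(@mulVf _ p) ?gt_eqF// powRrM.
by apply: ge0_ler_powR; rewrite ?nnegrE ?powR_ge0 ?(ltW p0)// (le_trans _ ab) ?powR_ge0.
Qed.

Section local_size_estimate.
Context {R : realType} {n : nat} {p : R} {w : rvec R n.+1 -> R}
  (p1 : 1 < p) (hw : Muckenhoupt p w)
  (wpos : {ae lebesgue_rvec R n.+1, forall x, 0 < w x}).
Local Notation V := (rvec R n.+1).
Local Notation mu := (lebesgue_rvec R n.+1).

Local Notation W x r := (fine (wmeas w (eball x r))).
Local Notation N f E := (\int[mu]_(y in E) (`|f y| `^ p * w y)%:E)%E.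
Local Notation rad r k := (2 ^+ k * r).
Local Notation F f x r k := (fine (N f (hball x (rad r k)))).
Local Notation mean f x r k := ((F f x r k / W x (rad r k)) `^ p^-1).

Context {x0 : V} {r : R} (r0 : 0 < r)
  {f : V -> R} (mf : measurable_fun (@hspace R n) f)
  (f_fin : forall k, N f (hball x0 (rad r k)) \is a fin_num)
  {S : R} (hS : forall m, \sum_(k < m) mean f x0 r k <= S).

Let p0 : 0 < p. Proof. exact: lt_trans p1. Qed.
Let w0 x : 0 <= w x. Proof. by case: hw => -[]. Qed.

Let rad_gt0 k : 0 < rad r k. Proof. by rewrite mulr_gt0// exprn_gt0. Qed.
Let W0 k : 0 < W x0 (rad r k). Proof. exact: (fine_wmeas_gt0 p1 hw wpos). Qed.
Let F0 k : 0 <= F f x0 r k. Proof. by rewrite fine_ge0// (Lp_integral_ge0 hw). Qed.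

Lemma mean_bound_ge0 : 0 <= S.
Proof. by have := hS 0; rewrite big_ord0. Qed.

Lemma mean_le k : mean f x0 r k <= S.
Proof.
apply: le_trans (hS k.+1); rewrite big_ord_recr/= lerDr.
by apply: sumr_ge0 => i _; exact: powR_ge0.
Qed.

Lemma Lp_le_mean k : F f x0 r k <= S `^ p * W x0 (rad r k).
Proof.
rewrite -ler_pdivrMr; last exact: W0.
apply: powRV_le; [exact: p0|by apply: divr_ge0; [exact: F0|exact/ltW/W0]|exact: mean_le].
Qed.

Let mfE (E : set V) : E `<=` @hspace R n -> measurable_fun E f.
Proof. by move=> EH; apply: measurable_funS mf => //; exact: measurable_hspace. Qed.

Let real_hoelder (A m G U i : R) : 0 <= A -> 0 <= m -> 0 <= G -> 0 < U -> 0 <= i ->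
  U * i `^ p <= A * m `^ p * G -> i <= A `^ p^-1 * m * (G / U) `^ p^-1.
Proof.
move=> A0 m0 G0 U0 i0 h.
have GU : 0 <= G / U by rewrite divr_ge0// ltW.
have {h}: i `^ p <= A * m `^ p * (G / U) by rewrite mulrA ler_pdivlMr// mulrC.
move: (G / U) GU => q q0 h.
have -> : A `^ p^-1 * m * q `^ p^-1 = (A * m `^ p * q) `^ p^-1.
  by rewrite !powRM ?mulr_ge0 ?powR_ge0// -powRrM mulfV ?gt_eqF// powRr1.
have -> : i = (i `^ p) `^ p^-1 by rewrite -powRrM mulfV ?gt_eqF// powRr1.
apply: ge0_ler_powR; rewrite ?nnegrE ?powR_ge0 ?invr_ge0 ?(ltW p0) ?mulr_ge0 ?powR_ge0//.
Qed.

Lemma L1_le_mean k : (\int[mu]_(y in hball x0 (rad r k)) `|f y|%:E <=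
  (fine (Ap_const p w) `^ p^-1 * (2 * rad r k) ^+ n.+1 * mean f x0 r k)%:E)%E.
Proof.
have /= := Ap_hoelder p1 hw wpos (hball x0 (rad r k)) f x0 (rad r k) (rad_gt0 k)
  (measurable_hball _ _) (@subIsetl _ _ _) (mfE _ (@subIsetr _ _ _)).
have Af : Ap_const p w \is a fin_num.
  by rewrite ge0_fin_numE ?(Ap_const_ge0 hw)//; case: hw.
have A0 : 0 <= fine (Ap_const p w) by rewrite fine_ge0// (Ap_const_ge0 hw).
have mB0 : 0 <= fine (mu (eball x0 (rad r k))) by rewrite fine_ge0.
have mB : fine (mu (eball x0 (rad r k))) <= (2 * rad r k) ^+ n.+1.
  rewrite -lee_fin fineK ?lebesgue_eball_fin//; exact: lebesgue_eball_le.
have := fineK (f_fin k); have := fineK Af.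
have := fineK (lebesgue_eball_fin x0 (rad r k) (rad_gt0 k)).
move=> <- <- <-; rewrite (wmeas_eballE p1 hw wpos x0 (rad r k))// poweR_EFin.
have : (0 <= \int[mu]_(y in hball x0 (rad r k)) `|f y|%:E)%E by exact: integral_ge0.
(* The value +oo is excluded: w(B) > 0 would make the left side infinite while the right side is
   finite. *)
case: (\int[mu]_(y in _) `|f y|%:E)%E => [i||]//; last first.
  by rewrite poweRyr ?gt_eqF// gt0_muley ?lte_fin// leye_eq.
rewrite poweR_EFin -!EFinM !lee_fin => i0 h.
apply: le_trans (real_hoelder _ _ _ _ _ A0 mB0 (F0 k) (W0 k) i0 h) _.
by apply: ler_wpM2r; [exact: powR_ge0|apply: ler_wpM2l; rewrite ?powR_ge0].
Qed.

(** For k >= 1 the radius r is at most half of 2^k r, so the triangle inequality loses at most one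
    half. *)
Lemma far_vdist_ge x y k : (0 < k)%N -> eball x0 r x -> ~ eball x0 (rad r k) y ->
  rad r k / 2 <= vdist x y.
Proof.
move=> k0; rewrite /eball /= => x0x /negP; rewrite -leNgt => x0y.
have := vdist_triangle x0 x y.
have : 2 * r <= rad r k.
  by rewrite ler_pM2r// -[leLHS]expr1 ler_eXn2l// ltr1n.
lra.
Qed.

(** On the annulus between B_k and B_(k+1), k >= 1, the kernel is at most (2 / (2^k r))^(n+1), and
    [L1_le_mean] on B_(k+1) brings (2 * 2^(k+1) r)^(n+1); the product is 8^(n+1). The radius index m
    keeps the sum finite, but the bound is free of m. *)
Lemma size_integral_le (g : V -> R) m x : hball x0 r x ->
  measurable_fun (@hspace R n) g ->
  (forall y, hspace y -> `|g y| <= `|f y|) ->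
  (forall y, eball x0 (rad r 1) y -> g y = 0) ->
  (forall y, ~ eball x0 (rad r m) y -> g y = 0) ->
  (\int[mu]_(y in @hspace R n) (`|g y| / vdist (Defs.vrefl x) y ^+ n.+1)%:E <=
   (8 ^+ n.+1 * fine (Ap_const p w) `^ p^-1 * S)%:E)%E.
Proof.
move=> [x0x hx] mg gf g1 gm.
pose c k : R := (2 / rad r k) ^+ n.+1.
have c0 k : 0 <= c k by rewrite exprn_ge0// divr_ge0// ltW.
pose u k (y : V) : \bar R := ((c k)%:E * ((fun z => `|f z|%:E) \_ (hball x0 (rad r k.+1))) y)%E.
have patch0 k y : (0 <= ((fun z => `|f z|%:E) \_ (hball x0 (rad r k.+1))) y)%E.
  by rewrite /patch; case: ifP.
have u0 k y : (0 <= u k y)%E by rewrite /u mule_ge0 ?lee_fin.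
have mpatch k : measurable_fun (@hspace R n) ((fun z => `|f z|%:E) \_ (hball x0 (rad r k.+1))).
  apply/(measurable_restrict _ (measurable_hball _ _) (measurable_hspace)).
  apply/measurable_EFinP; apply: (measurableT_comp (@normr_measurable _ setT)).
  by apply: mfE; exact: subIsetl.
apply: (@le_trans _ _ (\int[mu]_(y in @hspace R n) \sum_(k < m) u k y)%E).
  apply: ge0_le_integral_dom => y hy.
    by rewrite lee_fin divr_ge0// exprn_ge0// vdist_ge0.
  have [->|gy] := eqVneq (g y) 0.
    by rewrite normr0 mul0r; apply: sume_ge0.
  have y1 : ~ eball x0 (rad r 1) y by move/g1/eqP; rewrite (negbTE gy).
  have ym : eball x0 (rad r m) y.
    by apply: contrapT => /gm /eqP; rewrite (negbTE gy).
  (* The annulus containing y. Its index is positive because y lies outside B_1, as [far_vdist_ge]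
     requires. *)
  have [k [km yk ySk]] : exists k, [/\ (k < m)%N, ~ eball x0 (rad r k) y & eball x0 (rad r k.+1) y].
    elim: m ym {gm} => [ym|m IH ym].
      by exfalso; apply: y1; apply: le_eball ym; rewrite ler_pM2r// ler_eXn2l// ltr1n.
    have [ym'|ym'] := pselect (eball x0 (rad r m) y); last by exists m.
    by have [k [km h1 h2]] := IH ym'; exists k; split => //; exact: ltnW.
  have k0 : (0 < k)%N.
    by case: k {km} yk ySk => // _ /y1.
  rewrite (bigD1 (Ordinal km))//=.
  apply: (@le_trans _ _ (u k y)); last by rewrite leeDl// sume_ge0.
  rewrite /u /patch mem_set; last by [].
  rewrite -EFinM lee_fin mulrC.
  have dk : rad r k / 2 <= vdist (Defs.vrefl x) y.
    by apply: le_trans (vdist_vrefl x y hx hy); exact: far_vdist_ge.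
  have d0 : 0 < rad r k / 2 by rewrite divr_gt0.
  have d1 : 0 < vdist (Defs.vrefl x) y by exact: lt_le_trans dk.
  apply: ler_pM; [by rewrite invr_ge0 exprn_ge0// ltW|by []| |exact: gf].
  rewrite -exprVn /c; apply: lerXn2r; rewrite ?nnegrE ?invr_ge0 ?(ltW d1)//.
    by rewrite divr_ge0// ltW.
  by rewrite -[leRHS]invrK invf_div lef_pV2.
rewrite ge0_integral_sum; last 3 first.
- exact: measurable_hspace.
- by move=> k; apply: emeasurable_funM => //; exact: mpatch.
- by move=> k y _; exact: u0.
apply: (@le_trans _ _ (\sum_(k < m) (8 ^+ n.+1 * fine (Ap_const p w) `^ p^-1 * mean f x0 r k.+1)%:E)%E).
  apply: lee_sum => k _; rewrite /u ge0_integralZl; last 4 first.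
  - exact: measurable_hspace.
  - exact: mpatch.
  - by move=> y _; exact: patch0.
  - by rewrite lee_fin.
  rewrite -integral_mkcondr setIidr; last exact: subIsetr.
  apply: (le_trans (lee_wpmul2l _ (L1_le_mean k.+1))); first by rewrite lee_fin.
  have e : c k * (2 * rad r k.+1) ^+ n.+1 = 8 ^+ n.+1.
    rewrite /c -exprMn; congr (_ ^+ _); rewrite exprS.
    have : 0 < 2 ^+ k :> R by rewrite exprn_gt0.
    by move: (2 ^+ k) => b b0; field; rewrite !gt_eqF.
  rewrite -EFinM lee_fin -e le_eqVlt; apply/orP; left; apply/eqP.
  move: (mean f x0 r k.+1) (c k) (_ ^+ n.+1) (_ `^ _) => a b d A.
  by ring.
rewrite sumEFin lee_fin -mulr_sumr.
apply: ler_wpM2l; first by rewrite mulr_ge0 ?powR_ge0 ?exprn_ge0.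
(* The means run over the indices 1 to m; adding the term of index 0 completes them to a partial sum
   bounded by S. *)
apply: le_trans (hS m.+1); rewrite big_ord_recl lerDr; exact: powR_ge0.
Qed.

End local_size_estimate.

(** * Estimates for the operator *)

Section operator.
Context {R : realType} {n : nat} {p : R} {w : rvec R n.+1 -> R}
  (p1 : 1 < p) (hw : Muckenhoupt p w)
  (wpos : {ae lebesgue_rvec R n.+1, forall x, 0 < w x}).
Local Notation V := (rvec R n.+1).
Local Notation mu := (lebesgue_rvec R n.+1).
Local Notation H := (@hspace R n).

Local Notation W x r := (fine (wmeas w (eball x r))).
Local Notation N f E := (\int[mu]_(y in E) (`|f y| `^ p * w y)%:E)%E.
Local Notation rad r k := (2 ^+ k * r).
Local Notation F f x r k := (fine (N f (hball x (rad r k)))).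
Local Notation mean f x r k := ((F f x r k / W x (rad r k)) `^ p^-1).

Let p0 : 0 < p. Proof. exact: lt_trans p1. Qed.
Let w0 x : 0 <= w x. Proof. by case: hw => -[]. Qed.
Let mH : measurable H. Proof. exact: measurable_hspace. Qed.
Let pw_ge0 (g : V -> R) y : (0 <= (`|g y| `^ p * w y)%:E)%E.
Proof. by rewrite lee_fin mulr_ge0 ?powR_ge0. Qed.

Lemma LpwP (g : V -> R) : Lpw p w g <-> measurable_fun H g /\ (N g H < +oo)%E.
Proof.
rewrite /Lpw /Lpw_norm; split => -[mg h]; split => //; last exact: poweR_lty.
move: h; have := Lp_integral_ge0 hw g H.
case: (N g H) => [a _ _|_|//]; first exact: ltry.
by rewrite poweRyr ?ltxx// invr_eq0 gt_eqF.
Qed.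

Lemma Lp_integral_patch (g : V -> R) (A E : set V) :
  N (g \_ E) A = N g (A `&` E).
Proof.
rewrite integral_mkcondr; apply: eq_integral => y _; rewrite /patch.
by case: ifP => // _; rewrite normr0 powR0 ?mul0r// gt_eqF.
Qed.

Lemma measurable_patch (g : V -> R) (E : set V) : measurable E ->
  measurable_fun H g -> measurable_fun H (g \_ E).
Proof.
move=> mE mg; apply/(measurable_restrict _ mE mH).
by apply: measurable_funS mg => //; exact: subIsetl.
Qed.

Lemma Lpw_patch (g : V -> R) (E : set V) : measurable E ->
  Lpw p w g -> Lpw p w (g \_ E).
Proof.
move=> mE /LpwP [mg Ng]; apply/LpwP; split; first exact: measurable_patch.
rewrite Lp_integral_patch; apply: le_lt_trans Ng.
apply: (le_Lp_integral hw) => //; exact: measurableI.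
Qed.

(** The p-th power form of boundedness. The given bound A has no prescribed sign, hence [|A|]. *)
Lemma bounded_Lp_integral (T : (V -> R) -> V -> R) : bounded_on_Lpw p w T ->
  exists A : R, 0 <= A /\ forall g, Lpw p w g ->
    measurable_fun H (T g) /\ (N (T g) H <= A%:E * N g H)%E.
Proof.
move=> [A hA]; exists (`|A| `^ p); split; first exact: powR_ge0.
move=> g Lg; have [[mT _] h] := hA g Lg; split => //.
have Ng := Lp_integral_ge0 hw g H; have NT := Lp_integral_ge0 hw (T g) H.
have {}h : (Lpw_norm p w (T g) <= `|A|%:E * Lpw_norm p w g)%E.
  by apply: (le_trans h); apply: lee_wpmul2r; rewrite ?poweR_ge0// lee_fin ler_norm.
move: Ng NT h; rewrite /Lpw_norm; move: (N g H) (N (T g) H) => a b a0 b0 h.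
have /= := @gt0_ler_poweR R p (ltW p0) _ _ _ _ h.
rewrite !in_itv/= !leey !andbT mule_ge0 ?poweR_ge0 ?lee_fin//.
move=> /(_ isT isT); rewrite poweRM ?poweR_ge0 ?lee_fin//.
by rewrite -!poweRrM mulVf ?gt_eqF// !poweRe1// poweR_EFin.
Qed.

(** Functions of L_{p,w} are integrable on bounded sets: an infinite L_1 integral would contradict
    [Ap_hoelder] on a ball containing the box. This makes the size condition applicable to pieces of
    g. *)
Lemma L1_compact_support_patch (g : V -> R) (k : nat) (E : set V) :
  measurable E -> E `<=` exhaust k -> Lpw p w g -> L1_compact_support (g \_ E).
Proof.
move=> mE Ek /LpwP [mg Ng].
have mgE := measurable_patch g E mE mg.
split; last first.
  exists (exhaust k); split; [exact: compact_exhaust|exact: exhaust_hspace|].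
  by move=> y _ ky; rewrite /patch memNset// => /Ek.
pose x0 : V := [tuple 0%R | i < n.+1].
have [M [M0 kM]] := compact_rvec_bounded (exhaust k) x0 (compact_exhaust k).
apply/integrableP; split; first exact/measurable_EFinP.
rewrite (_ : (\int[mu]_(x in H) _)%E = (\int[mu]_(x in H `&` E) `|g x|%:E)%E); last first.
  rewrite integral_mkcondr; apply: eq_integral => y _; rewrite /patch /=.
  by case: ifP => // _; rewrite normr0.
have mHE : measurable (H `&` E) by exact: measurableI.
have := Ap_hoelder p1 hw wpos (H `&` E) g x0 M M0 mHE.
move=> /(_ (fun y hy => kM y (Ek y hy.2))).
move=> /(_ (measurable_funS mH (@subIsetl _ _ _) mg)) h.
rewrite ltNge leye_eq; apply/negP => /eqP goo; move: h.
rewrite goo poweRyr ?gt_eqF// gt0_muley; last exact: (wmeas_eball_gt0 p1 hw wpos).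
rewrite leye_eq => /eqP h.
suff : (Ap_const p w * mu (eball x0 M) `^ p * N g (H `&` E) < +oo)%E by rewrite h ltxx.
have Ap0 := Ap_const_ge0 hw; have [_ Apoo] := hw.
rewrite lte_mul_pinfty ?mule_ge0 ?poweR_ge0//.
  rewrite fin_numM ?fin_num_poweR ?lebesgue_eball_fin//.
  by rewrite ge0_fin_numE.
apply: le_lt_trans Ng; apply: (le_Lp_integral hw) => //; exact: subIsetl.
Qed.

(** Dominated convergence with majorant |g|^p w: each point of the half-space eventually belongs to
    the boxes. *)
Lemma Lp_tail_small (g : V -> R) (e : R) : Lpw p w g -> 0 < e ->
  exists k, (N (g \_ (~` exhaust k)) H <= e%:E)%E.
Proof.
move=> /LpwP [mg Ng] e0.
pose u k := (fun y => (`|(g \_ (~` exhaust k)) y| `^ p * w y)%:E).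
have mu_ k : measurable_fun H (u k).
  apply: (measurable_Lp_integrand hw) => //.
  by apply: measurable_patch => //; apply: measurableC; exact: measurable_exhaust.
have [||||_ _ h] := @dominated_convergence _ _ _ mu H mH u (cst 0%E)
    (fun y => (`|g y| `^ p * w y)%:E) mu_.
- exact: measurable_cst.
- apply: aeW => y hy.
  apply: cvg_near_cst; near=> k.
  have ky : exhaust k y by near: k; exact: near_exhaust.
  rewrite /u /patch memNset; last by move=> /(_ ky).
  by rewrite normr0 powR0 ?mul0r// gt_eqF.
- apply/integrableP; split; first exact: (measurable_Lp_integrand hw).
  by under eq_integral do rewrite gee0_abs ?pw_ge0//.
- apply: aeW => y k hy; rewrite gee0_abs ?pw_ge0// /u lee_fin.
  apply: ler_wpM2r => //; apply: ge0_ler_powR; rewrite ?nnegrE ?(ltW p0)//.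
  by rewrite /patch; case: ifP => // _; rewrite normr0.
move: h; rewrite integral0 => h.
have /h [k _ hk] : nbhs (0%E : \bar R) [set y | (y < e%:E)%E].
  apply: open_nbhs_nbhs; split; last by rewrite /= lte_fin.
  exact: (@open_ereal_lt_ereal R e%:E).
by exists k; apply/ltW/hk => /=.
Unshelve. all: by end_near. Qed.

End operator.

(** * Local estimate for functions of L_{p,w} *)

Lemma ge0_integralZD {d} {X : measurableType d} {R : realType}
    (m : {measure set X -> \bar R}) (E : set X) (c : R) (u v : X -> R) :
  measurable E -> 0 <= c -> measurable_fun E u -> measurable_fun E v ->
  (forall x, 0 <= u x) -> (forall x, 0 <= v x) ->
  (\int[m]_(x in E) (c * (u x + v x))%:E =
   c%:E * (\int[m]_(x in E) (u x)%:E + \int[m]_(x in E) (v x)%:E))%E.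
Proof.
move=> mE c0 mu mv u0 v0.
under eq_integral do rewrite EFinM.
rewrite ge0_integralZl ?lee_fin//; last 2 first.
- by apply/measurable_EFinP; exact: measurable_funD.
- by move=> x _; rewrite lee_fin addr_ge0.
under eq_integral do rewrite EFinD.
rewrite ge0_integralD//; try exact/measurable_EFinP; by move=> x _; rewrite lee_fin.
Qed.

Section operator_on_Lpw.
Context {R : realType} {n : nat} {p : R} {w : rvec R n.+1 -> R}
  (p1 : 1 < p) (hw : Muckenhoupt p w)
  (wpos : {ae lebesgue_rvec R n.+1, forall x, 0 < w x}).
Local Notation V := (rvec R n.+1).
Local Notation mu := (lebesgue_rvec R n.+1).
Local Notation H := (@hspace R n).

Local Notation W x r := (fine (wmeas w (eball x r))).
Local Notation N f E := (\int[mu]_(y in E) (`|f y| `^ p * w y)%:E)%E.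
Local Notation rad r k := (2 ^+ k * r).
Local Notation F f x r k := (fine (N f (hball x (rad r k)))).
Local Notation mean f x r k := ((F f x r k / W x (rad r k)) `^ p^-1).

Context {C0 : R} {D : set (V -> R)} {T : (V -> R) -> V -> R}
  (hD : linear_space D) (hD_Lpw : Lpw p w `<=` D) (hT : sublinear_on D T)
  (hT_size : size_condition T C0)
  {A : R} (A0 : 0 <= A) (hA : forall g, Lpw p w g ->
    measurable_fun H (T g) /\ (N (T g) H <= A%:E * N g H)%E).

Let p0 : 0 < p. Proof. exact: lt_trans p1. Qed.
Let mw : measurable_fun setT w. Proof. by case: hw => -[]. Qed.
Let w0 x : 0 <= w x. Proof. by case: hw => -[]. Qed.
Let mH : measurable H. Proof. exact: measurable_hspace. Qed.

Section local_estimate.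
Context {x0 : V} {r : R} (r0 : 0 < r)
  {f : V -> R} (mf : measurable_fun H f)
  (f_fin : forall k, N f (hball x0 (rad r k)) \is a fin_num)
  {S : R} (hS : forall m, \sum_(k < m) mean f x0 r k <= S)
  {g : V -> R} (Lg : Lpw p w g) (gf : forall y, H y -> `|g y| <= `|f y|).

Let B : R := `|C0| * (8 ^+ n.+1 * fine (Ap_const p w) `^ p^-1 * S).

(** The function g will be f itself or one of its truncations, while the bound [B] is built from f
    alone; it is thus uniform over truncations, and also over the box index k. *)
Lemma far_part_bound k : {ae mu, forall x, hball x0 r x ->
  `|T (g \_ (exhaust k `\` eball x0 (rad r 1))) x| <= B}.
Proof.
set h := g \_ _.
have mE : measurable (exhaust k `\` eball x0 (rad r 1) : set V).
  by apply: measurableD; [exact: measurable_exhaust|exact: measurable_eball].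
have mg : measurable_fun H g by have [] := (LpwP p1 hw g).1 Lg.
have [M [M0 kM]] := compact_rvec_bounded (exhaust k) x0 (compact_exhaust k).
(* The box is bounded, so finitely many annuli cover it. *)
have [m Mm] : exists m, M <= rad r m.
  have [m _ hm] := nbhs_infty_ger (M / r).
  exists m; rewrite -ler_pdivrMr//; apply: (le_trans (hm m (leqnn m))).
  by rewrite -natrX ler_nat ltnW// ltn_expl.
have := hT_size h (L1_compact_support_patch p1 hw wpos g k _ mE (@subDsetl _ _ _) Lg).
apply: filterS => x hTx Bx; rewrite -lee_fin; apply: (le_trans (hTx Bx.2)).
apply: (@le_trans _ _ (`|C0|%:E * \int[mu]_(y in H) (`|h y| / vdist (Defs.vrefl x) y ^+ n.+1)%:E)%E).
  apply: lee_wpmul2r; last by rewrite lee_fin ler_norm.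
  by apply: integral_ge0 => y _; rewrite lee_fin divr_ge0// exprn_ge0// vdist_ge0.
rewrite /B EFinM; apply: lee_wpmul2l; first by rewrite lee_fin.
apply: (size_integral_le p1 hw wpos r0 mf f_fin hS h m x Bx).
- exact: (measurable_patch g _ mE mg).
- by move=> y hy; rewrite /h /patch; case: ifP => _; [exact: gf|rewrite normr0].
- by move=> y By; rewrite /h /patch memNset// => -[_]; apply.
- by move=> y By; rewrite /h /patch memNset// => -[/kM ky _]; apply: By; exact: le_eball ky.
Qed.

(** Subadditivity is used twice, for near part plus rest and for far part plus tail, so [powRD_le]
    gives nested factors 2^p. The near part and the tail are handled by boundedness on L_{p,w}, the
    far part by [far_part_bound]. *)
Lemma local_estimate_split k : (N (T g) (hball x0 r) <=
  (2 `^ p)%:E * (A%:E * (F f x0 r 1)%:E + (2 `^ p)%:E *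
    ((B `^ p * W x0 r)%:E + A%:E * N (g \_ (~` exhaust k)) H)))%E.
Proof.
pose E1 : set V := exhaust k `&` eball x0 (rad r 1).
pose E2 : set V := exhaust k `\` eball x0 (rad r 1).
pose E3 : set V := ~` exhaust k.
have mK : measurable (exhaust k : set V) by exact: measurable_exhaust.
have mE1 : measurable E1 by apply: measurableI => //; exact: measurable_eball.
have mE2 : measurable E2 by apply: measurableD => //; exact: measurable_eball.
have mE3 : measurable E3 by exact: measurableC.
have L1 := Lpw_patch p1 hw g E1 mE1 Lg.
have L2 := Lpw_patch p1 hw g E2 mE2 Lg.
have L3 := Lpw_patch p1 hw g E3 mE3 Lg.
(* An equality at every point, since T acts on functions and not on classes modulo null sets. *)
have gE : g = (fun z => (g \_ E1) z + ((fun z => (g \_ E2) z + (g \_ E3) z) z)).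
  apply/funext => z; rewrite /patch /E1 /E2 /E3 in_setI in_setD in_setC.
  by case: (z \in exhaust k); case: (z \in eball _ _); rewrite /= ?addr0 ?add0r.
have [_ DD _] := hD. have [_ hadd _] := hT.
have := hadd _ _ (hD_Lpw _ L1) (DD _ _ (hD_Lpw _ L2) (hD_Lpw _ L3)).
rewrite -gE => h1; have h2 := hadd _ _ (hD_Lpw _ L2) (hD_Lpw _ L3).
have h3 := far_part_bound k.
have B0 : 0 <= B.
  rewrite /B mulr_ge0// mulr_ge0 ?(mean_bound_ge0 hS)// mulr_ge0 ?powR_ge0//.
have subBH : hball x0 r `<=` H by exact: subIsetr.
have mB : measurable (hball x0 r) by exact: measurable_hball.
have mT (u : V -> R) : Lpw p w u -> measurable_fun (hball x0 r) (T u).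
  by move=> /hA [mTu _]; apply: measurable_funS mTu.
have mN (u : V -> R) : Lpw p w u -> measurable_fun (hball x0 r) (fun y => `|T u y| `^ p * w y).
  by move=> /mT mTu; apply/measurable_EFinP; exact: (measurable_Lp_integrand hw).
have mwB c : measurable_fun (hball x0 r) (fun y => c * w y).
  by apply: measurable_funM => //; exact: measurable_funTS.
have pw0 (u : V -> R) y : 0 <= `|u y| `^ p * w y by rewrite mulr_ge0 ?powR_ge0.
have cw0 y : 0 <= B `^ p * w y by rewrite mulr_ge0 ?powR_ge0.
have pp0 : 0 <= 2 `^ p :> R by exact: powR_ge0.
apply: (@le_trans _ _ (\int[mu]_(y in hball x0 r) (2 `^ p * (`|T (g \_ E1) y| `^ p * w y +
    2 `^ p * (B `^ p * w y + `|T (g \_ E3) y| `^ p * w y)))%:E)%E).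
  apply: ae_ge0_le_integral => //.
  - by move=> y _; rewrite lee_fin.
  - by apply/measurable_EFinP; exact: mN.
  - by move=> y _; rewrite lee_fin mulr_ge0// addr_ge0// mulr_ge0// addr_ge0.
  - apply/measurable_EFinP; apply: measurable_funM => //; apply: measurable_funD; first exact: mN.
    by apply: measurable_funM => //; apply: measurable_funD; [exact: mwB|exact: mN].
  have : {ae mu, forall x, (hspace x -> `|T g x| <= `|T (g \_ E1) x| + `|T (fun z => (g \_ E2) z + (g \_ E3) z) x|) /\
     (hspace x -> `|T (fun z => (g \_ E2) z + (g \_ E3) z) x| <= `|T (g \_ E2) x| + `|T (g \_ E3) x|) /\
     (hball x0 r x -> `|T (g \_ E2) x| <= B)}.
    by apply: filterS3 h1 h2 h3 => x; split.
  apply: filterS => y [a1 [a2 a3]] By; rewrite lee_fin.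
  have Hy := subBH _ By; have {}a1 := a1 Hy; have {}a2 := a2 Hy; have {}a3 := a3 By.
  rewrite -mulrDl mulrA -mulrDl mulrA; apply: ler_wpM2r => //.
  have {}a2 : `|T (fun z => (g \_ E2) z + (g \_ E3) z) y| <= B + `|T (g \_ E3) y|.
    by apply: (le_trans a2); rewrite lerD2r.
  have {}a1 : `|T g y| <= `|T (g \_ E1) y| + (B + `|T (g \_ E3) y|).
    by apply: (le_trans a1); rewrite lerD2l.
  apply: (@le_trans _ _ ((`|T (g \_ E1) y| + (B + `|T (g \_ E3) y|)) `^ p)).
    by apply: ge0_ler_powR => //; rewrite ?nnegrE ?addr_ge0// ltW.
  apply: (le_trans (powRD_le _ _ _ _ (ltW p0) (normr_ge0 _) _)); first by rewrite addr_ge0.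
  by apply: ler_wpM2l => //; rewrite lerD2l powRD_le// ltW.
rewrite ge0_integralZD//; last 3 first.
- exact: mN.
- by apply: measurable_funM => //; apply: measurable_funD; [exact: mwB|exact: mN].
- by move=> y; rewrite mulr_ge0// addr_ge0.
rewrite ge0_integralZD//; last exact: mN.
have sub3 (u : V -> R) : Lpw p w u -> (N (T u) (hball x0 r) <= A%:E * N u H)%E.
  move=> Lu; have [mTu hTu] := hA u Lu; apply: le_trans hTu.
  exact: (le_Lp_integral hw).
apply: lee_wpmul2l; first by rewrite lee_fin.
apply: leeD.
  apply: (le_trans (sub3 _ L1)); apply: lee_wpmul2l; first by rewrite lee_fin.
  rewrite (fineK (f_fin 1)) (Lp_integral_patch p1).
  apply: (@le_trans _ _ (N g (hball x0 (rad r 1)))).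
    apply: (le_Lp_integral hw).
    - exact: measurableI.
    - exact: measurable_hball.
    - have [mg _] := (LpwP p1 hw g).1 Lg.
      by apply: measurable_funS mg => //; exact: subIsetr.
    - by move=> y [Hy [_ By]].
  apply: ge0_le_integral_dom => y [_ Hy]; rewrite lee_fin//.
  apply: ler_wpM2r => //; apply: ge0_ler_powR; rewrite ?nnegrE ?(ltW p0)//.
  exact: gf.
apply: lee_wpmul2l; first by rewrite lee_fin.
apply: leeD; last exact: sub3.
under eq_integral do rewrite EFinM.
rewrite ge0_integralZl//; last 3 first.
- by apply/measurable_EFinP; exact: measurable_funTS.
- by move=> y _; rewrite lee_fin.
- by rewrite lee_fin powR_ge0.
rewrite EFinM; apply: lee_wpmul2l; first by rewrite lee_fin powR_ge0.
by rewrite -(wmeas_eballE p1 hw wpos)//; exact: (wmeas_hball_le hw).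
Qed.

Lemma local_estimate_Lpw : (N (T g) (hball x0 r) <=
  (2 `^ p * (A * F f x0 r 1 + 2 `^ p * (B `^ p * W x0 r)))%:E)%E.
Proof.
apply/lee_addgt0Pr => e e0.
(* The coefficient of the tail in [local_estimate_split], increased by 1 so that e may be divided by
   it. *)
pose c : R := 2 `^ p * (2 `^ p * A) + 1.
have c0 : 0 < c by rewrite ltr_wpDl// !mulr_ge0 ?powR_ge0.
have [k hk] := Lp_tail_small p1 hw g (e / c) Lg (divr_gt0 e0 c0).
apply: (le_trans (local_estimate_split k)).
move: hk; have := Lp_integral_ge0 hw (g \_ (~` exhaust k)) H.
case: (N (g \_ _) _) => [t||]//; rewrite !lee_fin => t0 hk.
have : c * t <= e by rewrite mulrC -ler_pdivlMr.
rewrite /c; move: (2 `^ p) (F _ _ _ _) (B `^ p * _) => a b d; nra.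
Qed.

End local_estimate.
End operator_on_Lpw.

(** * Lower limits and passage to the Morrey space *)

Lemma limn_einfE (R : realType) (u : (\bar R)^nat) :
  limn_einf u = ereal_sup (range (einfs u)).
Proof. by rewrite limn_einf_lim; apply/cvg_lim => //; exact: cvg_einfs_sup. Qed.

Lemma lt_limn_einf (R : realType) (u : (\bar R)^nat) (x : \bar R) :
  (x < limn_einf u)%E -> exists m, forall k, (m <= k)%N -> (x <= u k)%E.
Proof.
rewrite limn_einfE => /ereal_sup_gt [_ [m _ <-] xm]; exists m => k mk.
by apply/ltW/(lt_le_trans xm); apply: ereal_inf_lbound; exists k.
Qed.

Lemma limn_einf_ge_near (R : realType) (u : (\bar R)^nat) (x : \bar R) m :
  (forall k, (m <= k)%N -> (x <= u k)%E) -> (x <= limn_einf u)%E.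
Proof.
move=> h; rewrite limn_einfE; apply: (@le_trans _ _ (einfs u m)).
  by apply: le_ereal_inf_tmp => _ [k /= mk <-]; exact: h.
by apply: ereal_sup_ubound; exists m.
Qed.

Lemma limn_einf_le_cst (R : realType) (u : (\bar R)^nat) (x : \bar R) :
  (forall k, (u k <= x)%E) -> (limn_einf u <= x)%E.
Proof.
move=> h; rewrite limn_einfE; apply: ge_ereal_sup => _ [m _ <-].
by apply: le_trans (h m); apply: ereal_inf_lbound; exists m => /=.
Qed.

Lemma measurable_limn_einf {d} {X : measurableType d} {R : realType} (E : set X)
    (u : (X -> \bar R)^nat) : (forall k, measurable_fun E (u k)) ->
  measurable_fun E (fun x => limn_einf (u ^~ x)).
Proof.
move=> mu; rewrite /limn_einf; apply: measurableT_comp => //.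
by apply: (@measurable_fun_limn_esup _ X R E (fun k x => - u k x)%E) => k;
  exact: measurableT_comp.
Qed.

Section operator_on_morrey.
Context {R : realType} {n : nat} {p : R} {w : rvec R n.+1 -> R}
  (p1 : 1 < p) (hw : Muckenhoupt p w)
  (wpos : {ae lebesgue_rvec R n.+1, forall x, 0 < w x}).
Local Notation V := (rvec R n.+1).
Local Notation mu := (lebesgue_rvec R n.+1).
Local Notation H := (@hspace R n).

Local Notation W x r := (fine (wmeas w (eball x r))).
Local Notation N f E := (\int[mu]_(y in E) (`|f y| `^ p * w y)%:E)%E.
Local Notation rad r k := (2 ^+ k * r).
Local Notation F f x r k := (fine (N f (hball x (rad r k)))).
Local Notation mean f x r k := ((F f x r k / W x (rad r k)) `^ p^-1).

Context {C0 : R} {D : set (V -> R)} {T : (V -> R) -> V -> R}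
  (hD : linear_space D) (hD_Lpw : Lpw p w `<=` D) (hT : sublinear_on D T)
  (hT_size : size_condition T C0) (hT_Lpw : bounded_on_Lpw p w T).

Let p0 : 0 < p. Proof. exact: lt_trans p1. Qed.
Let w0 x : 0 <= w x. Proof. by case: hw => -[]. Qed.
Let mH : measurable H. Proof. exact: measurable_hspace. Qed.

(** The near part is also controlled by S: a single mean gives the integral over B_1^+ as at most
    S^p w(B_1), and doubling returns to radius r. Since C precedes g, the bound passes through
    Fatou's lemma. *)
Lemma local_Lpw : exists C : R, 0 < C /\ forall (x0 : V) (r : R) (f : V -> R) (S : R) (g : V -> R),
  0 < r ->
  measurable_fun H f -> (forall k, N f (hball x0 (rad r k)) \is a fin_num) ->
  (forall m, \sum_(k < m) mean f x0 r k <= S) ->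
  Lpw p w g -> (forall y, H y -> `|g y| <= `|f y|) ->
  (N (T g) (hball x0 r) <= (C * (S `^ p * W x0 r))%:E)%E.
Proof.
have [A [A0 hA]] := bounded_Lp_integral p1 hw T hT_Lpw.
have [K [K0 hK]] := wmeas_double_radius p1 hw wpos.
pose b : R := `|C0| * (8 ^+ n.+1 * fine (Ap_const p w) `^ p^-1).
have b0 : 0 <= b by rewrite !mulr_ge0 ?powR_ge0 ?exprn_ge0.
exists (2 `^ p * (A * K + 2 `^ p * b `^ p) + 1); split.
  by rewrite ltr_wpDl// mulr_ge0 ?powR_ge0// addr_ge0 ?mulr_ge0 ?powR_ge0// ltW.
move=> x0 r f S g r0 mf f_fin hS Lg gf.
have S0 := mean_bound_ge0 hS.
apply: (le_trans (local_estimate_Lpw p1 hw wpos hD hD_Lpw hT hT_size A0 hA r0 mf f_fin hS Lg gf)).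
rewrite lee_fin.
have F1 : F f x0 r 1 <= S `^ p * (K * W x0 r).
  apply: (le_trans (Lp_le_mean p1 hw wpos r0 hS 1)).
  by apply: ler_wpM2l; [exact: powR_ge0|rewrite expr1; exact: hK].
have -> : `|C0| * (8 ^+ n.+1 * fine (Ap_const p w) `^ p^-1 * S) = b * S.
  by rewrite /b !mulrA.
rewrite powRM//.
have W0 : 0 <= W x0 r by apply/ltW/(fine_wmeas_gt0 p1 hw wpos).
have Sp0 : 0 <= S `^ p by exact: powR_ge0.
have AF : A * F f x0 r 1 <= A * (S `^ p * (K * W x0 r)) by exact: ler_wpM2l.
have SW : 0 <= S `^ p * W x0 r by exact: mulr_ge0.
have : 2 `^ p * (A * F f x0 r 1) <= 2 `^ p * (A * (S `^ p * (K * W x0 r))).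
  by apply: ler_wpM2l => //; exact: powR_ge0.
move: (2 `^ p) (S `^ p) (W x0 r) (F f x0 r 1) (b `^ p) SW {AF F1} => a s v F c SW h.
have -> : (a * (A * K + a * c) + 1) * (s * v) = a * (A * (s * (K * v))) + a * (a * (c * s * v)) + s * v.
  by ring.
by rewrite mulrDr -addrA lerD// lerDl.
Qed.

Let origin : V := [tuple of nseq _ 0%R].

Lemma truncation_Lpw (x0 : V) (r : R) (f : V -> R) m : 0 < r -> measurable_fun H f ->
  (forall k, N f (hball x0 (rad r k)) \is a fin_num) ->
  Lpw p w (f \_ (eball origin m%:R)).
Proof.
move=> r0 mf f_fin; have mB := measurable_eball origin m%:R.
apply/(LpwP p1 hw); split; first exact: measurable_patch.
rewrite (Lp_integral_patch p1).
have [k _ hk] := nbhs_infty_ger ((vdist x0 origin + m%:R) / r).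
have rk : vdist x0 origin + m%:R <= rad r k.
  rewrite -ler_pdivrMr//; apply: (le_trans (hk k (leqnn k))).
  by rewrite -natrX ler_nat ltnW// ltn_expl.
apply: (@le_lt_trans _ _ (N f (hball x0 (rad r k)))).
  apply: (le_Lp_integral hw).
  - exact: measurableI.
  - exact: measurable_hball.
  - by apply: measurable_funS mf => //; exact: subIsetr.
  - by move=> y [Hy By]; split => //; exact: eball_sub By.
by rewrite -ge0_fin_numE// (Lp_integral_ge0 hw).
Qed.

Lemma local_morrey : exists C : R, 0 < C /\ forall (x0 : V) (r : R) (f : V -> R) (S : R), 0 < r ->
  measurable_fun H f -> (forall k, N f (hball x0 (rad r k)) \is a fin_num) ->
  (forall m, \sum_(k < m) mean f x0 r k <= S) ->
  measurable_fun H (T f) -> (~ Lpw p w f -> dominated_by_truncations T f) ->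
  (N (T f) (hball x0 r) <= (C * (S `^ p * W x0 r))%:E)%E.
Proof.
have [C [C_gt0 hC]] := local_Lpw.
have pp0 : 0 < 2 `^ p :> R by exact: powR_gt0.
(* The term C serves f in L_{p,w}, the term 2^p C the limit of truncations. *)
exists ((1 + 2 `^ p) * C); split; first by rewrite mulr_gt0// addr_gt0.
move=> x0 r f S r0 mf f_fin hS mTf htr.
have S0 := mean_bound_ge0 hS.
have W0 : 0 <= W x0 r by apply/ltW/(fine_wmeas_gt0 p1 hw wpos).
have SW : 0 <= S `^ p * W x0 r by rewrite mulr_ge0 ?powR_ge0.
rewrite mulrDl mul1r mulrDl.
have [Lf|nLf] := pselect (Lpw p w f).
  apply: (le_trans (hC _ _ _ _ _ r0 mf f_fin hS Lf (fun _ _ => lexx _))).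
  by rewrite lee_fin lerDl; apply: mulr_ge0 => //; apply: mulr_ge0; exact: ltW.
pose g k := f \_ (eball origin k%:R).
have Lg k : Lpw p w (g k) by exact: truncation_Lpw r0 mf f_fin.
have mB : measurable (hball x0 r) by exact: measurable_hball.
have [A [_ hTL]] := bounded_Lp_integral p1 hw T hT_Lpw.
have mint (u : V -> R) : measurable_fun H u -> measurable_fun (hball x0 r) (fun y => (`|u y| `^ p * w y)%:E).
  move=> mu_; apply: (measurable_Lp_integrand hw) => //.
  by apply: measurable_funS mu_ => //; exact: subIsetr.
have mTg k := mint _ (hTL _ (Lg k)).1.
have int0 (u : V -> R) y : (0 <= (`|u y| `^ p * w y)%:E)%E by rewrite lee_fin mulr_ge0 ?powR_ge0.
(* The lower limit is taken after raising to the power p and weighting, in the form to which Fatou's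
   lemma applies. *)
pose L y := limn_einf (fun k => (`|T (g k) y| `^ p * w y)%:E).
have L0 y : (0 <= L y)%E by apply: (@limn_einf_ge_near _ _ _ 0%N).
have mL : measurable_fun (hball x0 r) L by exact: measurable_limn_einf.
apply: (@le_trans _ _ (\int[mu]_(y in hball x0 r) ((2 `^ p)%:E * L y))%E).
  apply: ae_ge0_le_integral => //.
  - exact: mint.
  - by move=> y _; rewrite mule_ge0// lee_fin ltW.
  - by apply: emeasurable_funM.
  apply: filterS (htr nLf) => y hy [_ /hy {}hy].
  have [->|Ty0] := eqVneq (T f y) 0.
    by rewrite normr0 powR0 ?mul0r ?gt_eqF// mule_ge0// lee_fin ltW.
  have Tpos : 0 < `|T f y| by rewrite normr_gt0.
  (* Halving makes the inequality strict, at the cost of the factor 2^p. *)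
  have : ((`|T f y| / 2)%:E < limn_einf (fun k => `|T (g k) y|%:E))%E.
    by apply: lt_le_trans hy; rewrite lte_fin ltr_pdivrMr// ltr_pMr// ltr1n.
  move=> /lt_limn_einf [m hm].
  apply: (@le_trans _ _ ((2 `^ p)%:E * ((`|T f y| / 2) `^ p * w y)%:E)%E).
    rewrite -EFinM lee_fin mulrA -powRM ?divr_ge0//.
    by rewrite [2 * _]mulrC divfK.
  apply: lee_wpmul2l; first by rewrite lee_fin ltW.
  apply: (@limn_einf_ge_near _ _ _ m) => k /hm; rewrite !lee_fin => h.
  by apply: ler_wpM2r => //; apply: ge0_ler_powR; rewrite ?nnegrE ?divr_ge0 ?(ltW p0).
rewrite ge0_integralZl; last 4 first.
- exact: mB.
- exact: mL.
- by move=> y _; exact: L0.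
- by rewrite lee_fin ltW.
apply: (@le_trans _ _ ((2 `^ p)%:E * (C * (S `^ p * W x0 r))%:E)%E).
  apply: lee_wpmul2l; first by rewrite lee_fin ltW.
  apply: (le_trans (fatou mu mB mTg (fun _ _ _ => int0 _ _))).
  apply: limn_einf_le_cst => k.
  apply: hC hS (Lg k) _ => // y _.
  by rewrite /g /patch; case: ifP => // _; rewrite normr0.
rewrite -EFinM lee_fin (mulrA (2 `^ p)) lerDr; apply: mulr_ge0 => //; exact: ltW.
Qed.

End operator_on_morrey.

(** * From half-balls to the Morrey norms *)

Section main_estimate.
Context {R : realType} {n : nat} {p : R} {w : rvec R n.+1 -> R}
  (p1 : 1 < p) (hw : Muckenhoupt p w).
Local Notation V := (rvec R n.+1).
Local Notation mu := (lebesgue_rvec R n.+1).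
Local Notation H := (@hspace R n).
Local Notation W x r := (fine (wmeas w (eball x r))).
Local Notation N f E := (\int[mu]_(y in E) (`|f y| `^ p * w y)%:E)%E.
Local Notation rad r k := (2 ^+ k * r).
Local Notation F f x r k := (fine (N f (hball x (rad r k)))).
Local Notation mean f x r k := ((F f x r k / W x (rad r k)) `^ p^-1).

Let p0 : 0 < p. Proof. exact: lt_trans p1. Qed.
Let w0 x : 0 <= w x. Proof. by case: hw => -[]. Qed.

Lemma Lpw_loc_bounded (f : V -> R) : measurable_fun H f ->
  (forall x r, H x -> 0 < r -> (N f (hball x r) < +oo)%E) -> Lpw_loc p w f.
Proof.
move=> mf hf; split => // K KH cK.
pose e : V := [tuple 1 | i < n.+1].
have He : H e by rewrite /hspace /= tnth_mktuple.
have [M [M0 KM]] := compact_rvec_bounded K e cK.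
apply: le_lt_trans (hf e M He M0).
rewrite [leLHS]integral_mkcond [leRHS]integral_mkcond.
apply: ge0_le_integral_dom => x _; rewrite /patch.
  by case: ifP => // _; rewrite lee_fin mulr_ge0 ?powR_ge0.
case: ifPn => [/set_mem Kx|_].
  by rewrite mem_set//; split; [exact: KM|exact: KH].
by case: ifP => // _; rewrite lee_fin mulr_ge0 ?powR_ge0.
Qed.

Lemma morrey_norm_ge0 (phi : V -> R -> R) (f : V -> R) :
  (forall x r, H x -> 0 < r -> 0 < phi x r) -> (0 <= morrey_norm p phi w f)%E.
Proof.
move=> phi0; pose e : V := [tuple 1 | i < n.+1].
have He : H e by rewrite /hspace /= tnth_mktuple.
apply: (@le_trans _ _ ((phi e 1)^-1%:E *
      ((wmeas w (hball e 1))^-1 * N f (hball e 1)) `^ p^-1)%E).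
  by rewrite mule_ge0 ?poweR_ge0// lee_fin invr_ge0 ltW// phi0.
by apply: ereal_sup_ubound; exists (e, 1).
Qed.

Lemma Lp_integral_null (f : V -> R) (E : set V) :
  {ae mu, forall x, w x = 0} -> measurable E -> measurable_fun E f -> N f E = 0%E.
Proof.
move=> wnull mE mf; rewrite (@ae_eq_integral _ _ _ _ _ (cst 0%E))//.
- by rewrite integral0.
- exact: (measurable_Lp_integrand hw).
by apply: filterS wnull => x wx _; rewrite wx mulr0.
Qed.

Context {phi1 phi2 : V -> R -> R}
  (phi1_gt0 : forall x r, H x -> 0 < r -> 0 < phi1 x r)
  (phi2_gt0 : forall x r, H x -> 0 < r -> 0 < phi2 x r).

(** Doubling replaces the weight of B_(k+1) in [pair_sum] by that of B_k, at the cost of K^(1/p).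
    The absolute value of C1 and the added 1 make the constant positive. *)
Lemma morrey_mean_sum {C1 : R} (hphi : weight_pair_condition p w phi1 phi2 C1)
    (wpos : {ae mu, forall x, 0 < w x}) :
  exists C : R, 0 < C /\ forall (f : V -> R) (M : R) x r m,
    measurable_fun H f -> 0 < M -> (morrey_norm p phi1 w f <= M%:E)%E ->
    H x -> 0 < r -> \sum_(k < m) mean f x r k <= C * (phi2 x r * M).
Proof.
have [K [K0 hK]] := wmeas_double_radius p1 hw wpos.
exists (K `^ p^-1 * (2 * `|C1|) + 1); split.
  by rewrite ltr_wpDl// mulr_ge0 ?powR_ge0 ?mulr_ge0.
move=> f M x r m mf M0 fM hx r0.
have pV0 : 0 <= p^-1 by rewrite invr_ge0 ltW.
have rad0 k : 0 < rad r k by rewrite mulr_gt0// exprn_gt0.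
have step k : mean f x r k <= K `^ p^-1 * (F f x r k `^ p^-1 / W x (rad r k.+1) `^ p^-1).
  have Fk : 0 <= F f x r k by rewrite fine_ge0// (Lp_integral_ge0 hw).
  have Wk := fine_wmeas_gt0 p1 hw wpos x _ (rad0 k).
  have Wk1 := fine_wmeas_gt0 p1 hw wpos x _ (rad0 k.+1).
  have radS : 2 * rad r k = rad r k.+1 by rewrite exprS mulrA.
  have := hK x _ (rad0 k); rewrite radS.
  move: (F f x r k) (W x (rad r k)) (W x (rad r k.+1)) Fk Wk Wk1 => {}F u v F0 u0 v0 vu.
  have -> : K `^ p^-1 * (F `^ p^-1 / v `^ p^-1) = (K * F / v) `^ p^-1.
    rewrite [K * F / v]mulrAC -mulrA powRM ?mulr_ge0 ?invr_ge0 ?(ltW v0) ?(ltW K0)//.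
    rewrite powRM ?mulr_ge0 ?invr_ge0 ?(ltW v0)// mulrC [in RHS]mulrC.
    by rewrite -(powR_inv1 (ltW v0)) powRAC (powR_inv1 (powR_ge0 v _)) [_^-1 * _]mulrC.
  apply: ge0_ler_powR; rewrite ?nnegrE ?divr_ge0 ?mulr_ge0 ?(ltW u0) ?(ltW v0) ?(ltW K0)//.
  by rewrite ler_pdivrMr// mulrAC ler_pdivlMr// mulrC -mulrA [F * u]mulrC mulrA ler_wpM2r.
apply: (@le_trans _ _ (K `^ p^-1 * (2 * M * (C1 * phi2 x r)))).
  apply: (@le_trans _ _ (\sum_(k < m)
      K `^ p^-1 * (F f x r k `^ p^-1 / W x (rad r k.+1) `^ p^-1))).
    by apply: ler_sum => k _; exact: step.
  rewrite -mulr_sumr; apply: ler_wpM2l; first exact: powR_ge0.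
  exact: (pair_sum p1 hw wpos phi1_gt0 mf M0 fM _ _ _ _ _ hx r0 hphi).
have ph := phi2_gt0 x r hx r0.
have PM : 0 < phi2 x r * M by rewrite mulr_gt0.
have h1 : C1 * (phi2 x r * M) <= `|C1| * (phi2 x r * M).
  by rewrite ler_pM2r// ler_norm.
have h2 : K `^ p^-1 * (C1 * (phi2 x r * M)) <= K `^ p^-1 * (`|C1| * (phi2 x r * M)).
  by apply: ler_wpM2l => //; exact: powR_ge0.
move: (K `^ _) (phi2 x r) `|C1| {h1} h2 PM => a c b; nra.
Qed.

Context {C0 C1 : R} {D : set (V -> R)} {T : (V -> R) -> V -> R}
  (hphi : weight_pair_condition p w phi1 phi2 C1)
  (hD : linear_space D) (hD_Lpw : Lpw p w `<=` D)
  (hD_morrey : morrey p phi1 w `<=` D) (hT : sublinear_on D T)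
  (hT_size : size_condition T C0) (hT_Lpw : bounded_on_Lpw p w T)
  (hT_trunc : forall f, morrey p phi1 w f -> ~ Lpw p w f ->
       dominated_by_truncations T f).

(** M is an arbitrary positive bound rather than the norm, which may be 0, because [pair_sum]
    divides by M. With S = Cs phi2 M in [local_morrey], [wmeas_hball] turns w(B) into w(B^+), and
    phi2 cancels against the factor phi2^-1 of the norm. *)
Lemma morrey_estimate (wpos : {ae mu, forall x, 0 < w x}) :
  exists C : R, 0 < C /\ forall (f : V -> R) (M : R), morrey p phi1 w f ->
    0 < M -> (morrey_norm p phi1 w f <= M%:E)%E ->
    (forall x r, H x -> 0 < r -> (N (T f) (hball x r) < +oo)%E) /\
    (morrey_norm p phi2 w (T f) <= (C * M)%:E)%E.
Proof.
have [Cs [Cs0 hCs]] := morrey_mean_sum hphi wpos.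
have [Cl [Cl0 hCl]] := local_morrey p1 hw wpos hD hD_Lpw hT hT_size hT_Lpw.
have [Kh [Kh0 hKh]] := wmeas_hball p1 hw wpos.
exists ((Cl * Kh) `^ p^-1 * Cs); split; first by rewrite mulr_gt0 ?powR_gt0 ?mulr_gt0.
move=> f M hf M0 fM.
have mf : measurable_fun H f by case: hf => -[].
have mTf : measurable_fun H (T f) by have [+ _ _] := hT; apply; exact: hD_morrey.
have loc x r : H x -> 0 < r ->
    (N (T f) (hball x r) <= (Cl * ((Cs * (phi2 x r * M)) `^ p * W x r))%:E)%E.
  move=> hx r0; apply: hCl => //.
  - move=> k; apply: (morrey_ball_fin p1 hw wpos phi1_gt0 M0 fM) => //.
    by rewrite mulr_gt0// exprn_gt0.
  - by move=> m; exact: hCs.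
  - exact: hT_trunc.
split; first by move=> x r hx r0; rewrite (le_lt_trans (loc x r hx r0))// ltry.
apply: ge_ereal_sup => _ [[x r] /= [hx r0] <-].
have ph := phi2_gt0 x r hx r0.
have pV0 : 0 <= p^-1 by rewrite invr_ge0 ltW.
have h1 := loc x r hx r0; have h2 := hKh x r hx r0.
have h3 := wmeas_hball_fin p1 hw wpos x r r0; have h4 := wmeas_hball_gt0 p1 hw wpos x r hx r0.
have N0 := Lp_integral_ge0 hw (T f) (hball x r).
have W0 := fine_wmeas_gt0 p1 hw wpos x r r0.
move: h1 h2 h3 h4 N0 W0.
move: (W x r) (wmeas w (hball x r)) (N (T f) (hball x r)) => u [v| |]// [a| |]//.
rewrite -EFinM !lee_fin !lte_fin => h1 h2 _ v0 a0 u0.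
rewrite inver (gt_eqF v0) -(EFinM v^-1 a) poweR_EFin -EFinM lee_fin.
have S0 : 0 <= Cs * (phi2 x r * M) by rewrite !mulr_ge0// ltW.
rewrite -ler_pdivlMl ?invr_gt0// invrK.
have -> : phi2 x r * ((Cl * Kh) `^ p^-1 * Cs * M) = (Cl * Kh) `^ p^-1 * (Cs * (phi2 x r * M)) by ring.
have -> : (Cl * Kh) `^ p^-1 * (Cs * (phi2 x r * M)) =
   (Cl * Kh * (Cs * (phi2 x r * M)) `^ p) `^ p^-1.
  rewrite [in RHS]powRM ?powR_ge0 ?mulr_ge0 ?(ltW Cl0) ?(ltW Kh0)//.
  by rewrite -[in RHS]powRrM mulfV ?gt_eqF// powRr1.
have Sp0 : 0 <= (Cs * (phi2 x r * M)) `^ p by exact: powR_ge0.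
have CK0 : 0 <= Cl * Kh by rewrite mulr_ge0// ltW.
have va0 : 0 <= v^-1 * a by rewrite mulr_ge0// invr_ge0 ltW.
apply: ge0_ler_powR => //; first by rewrite nnegrE mulr_ge0.
rewrite ler_pdivrMl//; apply: (le_trans h1).
have : Cl * ((Cs * (phi2 x r * M)) `^ p * u) <= Cl * ((Cs * (phi2 x r * M)) `^ p * (Kh * v)).
  by apply: ler_wpM2l; [exact: ltW|apply: ler_wpM2l].
by move=> /le_trans; apply; rewrite le_eqVlt; apply/orP; left; apply/eqP; ring.
Qed.

(** Were it 0, [Ap_hoelder] with g = 1 would give w(B) |B|^p <= 0. *)
Lemma Ap_const_gt0 (wpos : {ae mu, forall x, 0 < w x}) : (0 < Ap_const p w)%E.
Proof.
rewrite lt0e (Ap_const_ge0 hw) andbT; apply/eqP => A0.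
pose e : V := [tuple 1 | i < n.+1].
have := Ap_hoelder p1 hw wpos (eball e 1) (cst 1) e 1 ltr01 (measurable_eball e 1)
  (@subset_refl _ _) (measurable_cst _).
rewrite A0 !mul0e leNgt => /negP; apply.
rewrite mule_gt0// ?(wmeas_eball_gt0 p1 hw wpos)// poweR_gt0//.
under eq_integral do rewrite normr1.
by rewrite integral_cst ?mul1e ?lebesgue_eball_gt0//; exact: measurable_eball.
Qed.

End main_estimate.

Theorem theorem1 (R : realType) (n : nat) (p C0 C1 : R)
    (w : rvec R n.+1 -> R) (phi1 phi2 : rvec R n.+1 -> R -> R)
    (D : set (rvec R n.+1 -> R)) (T : (rvec R n.+1 -> R) -> rvec R n.+1 -> R)
    (hp : 1 < p) (hw : Muckenhoupt p w)
    (hphi1 : positive_weight phi1) (hphi2 : positive_weight phi2)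
    (hphi : weight_pair_condition p w phi1 phi2 C1)
    (hD : linear_space D)
    (hD_L1 : @L1_compact_support R n `<=` D)
    (hD_Lpw : Lpw p w `<=` D)
    (hD_morrey : morrey p phi1 w `<=` D)
    (hT : sublinear_on D T)
    (hT_size : size_condition T C0)
    (hT_trunc : forall f, morrey p phi1 w f -> ~ Lpw p w f ->
       dominated_by_truncations T f)
    (hT_Lpw : bounded_on_Lpw p w T) :
  exists C : R, 0 < C /\
    forall f, morrey p phi1 w f ->
      morrey p phi2 w (T f) /\
      (morrey_norm p phi2 w (T f)
        <= C%:E * Ap_const p w `^ p^-1 * morrey_norm p phi1 w f)%E.
Proof.
have phi1_gt0 x r : hspace x -> 0 < r -> 0 < phi1 x r.
  by move=> hx r0; have [_ + _] := hphi1; move=> /(_ (x, r)); apply; split.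
have phi2_gt0 x r : hspace x -> 0 < r -> 0 < phi2 x r.
  by move=> hx r0; have [_ + _] := hphi2; move=> /(_ (x, r)); apply; split.
have mTf f : morrey p phi1 w f -> measurable_fun (@hspace R n) (T f).
  by move=> /hD_morrey Df; have [+ _ _] := hT; apply.
have A0 := Ap_const_ge0 hw.
have [wpos|wnull] := weight_dichotomy hp hw; last first.
  have null f x r : morrey p phi1 w f ->
      (\int[lebesgue_rvec R n.+1]_(y in hball x r) (`|T f y| `^ p * w y)%:E = 0)%E.
    move=> /mTf mf; apply: (Lp_integral_null hw _ _ wnull); first exact: measurable_hball.
    by apply: measurable_funS mf; [exact: measurable_hspace|exact: subIsetr].
  exists 1; split; first exact: ltr01.
  move=> f hf.
  (* Here w(B^+) = 0 has inverse +oo, and its product with the vanishing integral is 0. *)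
  have T0 : (morrey_norm p phi2 w (T f) <= 0)%E.
    apply: ge_ereal_sup => _ [[x r] /= _ <-].
    by rewrite null// mule0 poweR0r ?mule0// invr_eq0 gt_eqF// (lt_trans ltr01).
  split.
    split; last exact: le_lt_trans T0 _.
    by apply: (Lpw_loc_bounded hw) => [|x r _ _]; [exact: mTf|rewrite null].
  apply: (le_trans T0); rewrite mul1e mule_ge0 ?poweR_ge0//.
  exact: morrey_norm_ge0.
have [C [C_gt0 hC]] := morrey_estimate hp hw phi1_gt0 phi2_gt0 hphi hD hD_Lpw
  hD_morrey hT hT_size hT_Lpw hT_trunc wpos.
have Apos := Ap_const_gt0 hp hw wpos.
have Aoo : (Ap_const p w < +oo)%E by case: hw.
have Afin : Ap_const p w \is a fin_num by rewrite ge0_fin_numE.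
have a0 : 0 < fine (Ap_const p w) `^ p^-1.
  by rewrite powR_gt0// fine_gt0// Apos.
(* Dividing here makes the factor [w]^(1/p) of the conclusion cancel, leaving the constant of
   [morrey_estimate]. *)
exists (C / fine (Ap_const p w) `^ p^-1); split; first by rewrite divr_gt0.
move=> f hf; have foo : (morrey_norm p phi1 w f < +oo)%E by case: hf.
have f0 : (0 <= morrey_norm p phi1 w f)%E by exact: morrey_norm_ge0.
have ffin : morrey_norm p phi1 w f \is a fin_num by rewrite ge0_fin_numE.
have hM e : 0 < e -> (morrey_norm p phi1 w f <= (fine (morrey_norm p phi1 w f) + e)%:E)%E.
  by move=> e0; rewrite EFinD fineK// leeDl// lee_fin ltW.
have M0 e : 0 < e -> 0 < fine (morrey_norm p phi1 w f) + e.
  by move=> e0; rewrite ltr_wpDl// fine_ge0.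
split.
  have [h1 h2] := hC f _ hf (M0 1 ltr01) (hM 1 ltr01).
  split; last by rewrite (le_lt_trans h2)// ltry.
  by apply: (Lpw_loc_bounded hw) => //; exact: mTf.
have -> : ((C / fine (Ap_const p w) `^ p^-1)%:E * Ap_const p w `^ p^-1 * morrey_norm p phi1 w f =
   (C * fine (morrey_norm p phi1 w f))%:E)%E.
  rewrite -{2}(fineK Afin) poweR_EFin -EFinM divfK ?gt_eqF//.
  by rewrite EFinM fineK.
(* The estimate is used with M equal to the norm plus e/C, so that the excess is exactly e. *)
apply/lee_addgt0Pr => e e0.
have eC : 0 < e / C by rewrite divr_gt0.
have [_ h] := hC f _ hf (M0 _ eC) (hM _ eC).
apply: (le_trans h); rewrite -EFinD lee_fin mulrDr lerD2l.
by rewrite mulrC divfK// gt_eqF.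
Qed.
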